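(* Let $F:B_{\ell_2^d}\to\mathbb{R}^n$ be smooth, where $B_{\ell_2^d}$ is the closed unit Euclidean ball of $\mathbb{R}^d$, and suppose there is a constant $c_0\ge1$ with $c_0^{-1}\|x-y\|_2\le\|F(x)-F(y)\|_2\le c_0\|x-y\|_2$ and $\|DF(x)-DF(y)\|_{\ell_2^d\to\ell_2^n}\le c_0\|x-y\|_2$ for all $x,y\in B_{\ell_2^d}$. Let $\mathcal{M}=F(B_{\ell_2^d})$, let $\varepsilon\in(0,1/2)$, and let $\Phi\in\mathbb{R}^{m\times n}$ be the SJLT with column sparsity $s$. There are constants $C,c>0$ (depending only on $c_0$) such that if $m\ge Cd(\log n)^2$ and $s\ge C(\log n)^2$, then with probability at least $1-e^{-cs}$ the following holds: if $1-\varepsilon\le\|\Phi v\|_2\le1+\varepsilon$ for every unit tangent vector $v$ of $\mathcal{M}$, then $\Phi$ preserves geodesic distances up to factor $1+\varepsilon$, i.e., for all $x,y\in\mathcal{M}$, $$(1-\varepsilon)\rho_{\mathcal{M}}(x,y)\le\rho_{\Phi(\mathcal{M})}(\Phi x,\Phi y)\le(1+\varepsilon)\rho_{\mathcal{M}}(x,y).$$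
   Context: The tangent space of $\mathcal{M}$ at $F(u)$ is $DF(u)(\mathbb{R}^d)$; a unit tangent vector is a unit vector in some tangent space. For a set $\mathcal{N}\subset\mathbb{R}^n$ (here $\mathcal{M}$ or $\Phi(\mathcal{M})\subset\mathbb{R}^m$), $\rho_{\mathcal{N}}(a,b)$ is the geodesic distance: the infimum of the lengths of $C^1$ curves in $\mathcal{N}$ joining $a$ and $b$. SJLT with column sparsity $s$: $\Phi_{ij}=s^{-1/2}\sigma_{ij}\delta_{ij}$ with $(\sigma_{ij})$ independent Rademachers, $(\delta_{ij})\in\{0,1\}$ independent of $\sigma$, each column has exactly $s$ ones, for fixed $j$ and distinct $i_1,\dots,i_k$: $\mathbb{E}\prod_t\delta_{i_tj}\le(s/m)^k$, and columns independent across $j$. *)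

(* Defs.v *)
From HB Require Import structures.
From mathcomp Require Export all_boot all_order all_algebra.
From mathcomp Require Export all_classical all_reals all_analysis.

Set Implicit Arguments.
Unset Strict Implicit.
Unset Printing Implicit Defensive.

Export Order.TTheory GRing.Theory Num.Theory.
Export numFieldNormedType.Exports.

#[export] Set Implicit Arguments.
#[export] Unset Strict Implicit.
#[export] Unset Printing Implicit Defensive.

#[global] Open Scope classical_set_scope.
#[global] Open Scope ring_scope.

Section EuclideanNorm.
Context {R : realType}.

(* The library norm on 'cV[R]_n is the sup norm; it induces the same topology
   and the same differentials as the Euclidean one. *)
Definition l2norm (n : nat) (x : 'cV[R]_n) : R :=
  Num.sqrt (\sum_(i < n) x i 0 ^+ 2).

Definition l2ball d : set 'cV[R]_d := [set x | l2norm x <= 1].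

(* Only used on linear maps, for which the supremum is over a nonempty bounded
   set. *)
Definition l2opnorm (d n : nat) (f : 'cV[R]_d -> 'cV[R]_n) : R :=
  sup [set l2norm (f v) | v in @l2ball d].

End EuclideanNorm.

Arguments l2ball : clear implicits.

Section Smoothness.
Context {R : realType} {V W : normedModType R}.

(* For U open and V finite dimensional, this is the class C^k on U. *)
Fixpoint Ck_on (k : nat) (U : set V) (f : V -> W) : Prop :=
  if k is k'.+1 then
    (forall x, U x -> differentiable f x) /\
    (forall v : V, Ck_on k' U ('D_v f))
  else forall x, U x -> {for x, continuous f}.

(* Regularity on a set that need not be open (a closed ball, a compact
   interval) is regularity on some open neighbourhood of it. *)
Definition C1_on (A : set V) (f : V -> W) : Prop :=
  exists U : set V, [/\ open U, A `<=` U & Ck_on 1 U f].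

Definition smooth_on (A : set V) (f : V -> W) : Prop :=
  exists U : set V, [/\ open U, A `<=` U & forall k, Ck_on k U f].

End Smoothness.

Section Geometry.
Context {R : realType}.

Definition unit_itv : set R := `[0%R, 1%R]%classic.

Definition C1_curve_in (n : nat) (N : set 'cV[R]_n) (a b : 'cV[R]_n)
    (g : R -> 'cV[R]_n) : Prop :=
  [/\ C1_on unit_itv g, g @` unit_itv `<=` N,
      g 0 = a & g 1 = b].

Definition curve_length (n : nat) (g : R -> 'cV[R]_n) : \bar R :=
  (\int[lebesgue_measure]_(t in unit_itv)
     (l2norm (derive1 g t))%:E)%E.

(* +oo when no C^1 curve in N joins a and b *)
Definition geodesic_dist (n : nat) (N : set 'cV[R]_n) (a b : 'cV[R]_n)
    : \bar R :=
  ereal_inf [set curve_length g | g in C1_curve_in N a b].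

Definition tangent_space (d n : nat) (F : 'cV[R]_d -> 'cV[R]_n)
    (u : 'cV[R]_d) : set 'cV[R]_n :=
  range ('d F u).

Definition unit_tangent (d n : nat) (F : 'cV[R]_d -> 'cV[R]_n)
    : set 'cV[R]_n :=
  [set v | l2norm v = 1 /\ exists2 u, l2ball R d u & tangent_space F u v].

End Geometry.

Section Independence.
Context {R : realType} {disp : measure_display} {T : measurableType disp}.
Variable P : probability T R.

Definition sigma_algebra_of (I : Type) (X : I -> T -> R) : set (set T) :=
  <<s \bigcup_i preimage_set_system [set: T] (X i) measurable >>.

Definition independent2 (G H : set (set T)) : Prop :=
  forall A B : set T, G A -> H B -> P (A `&` B) = (P A * P B)%E.

Definition mutually_independent (I : finType) (G : I -> set (set T)) : Prop :=
  forall (J : {set I}) (A : I -> set T),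
    (forall i, i \in J -> G i (A i)) ->
    P (\bigcap_(i in [set` J]) A i) = (\prod_(i in J) P (A i))%E.

Definition rademacher (X : T -> R) : Prop :=
  [/\ forall w, X w = 1 \/ X w = -1,
      P [set w | X w = 1] = (2^-1)%:E & P [set w | X w = -1] = (2^-1)%:E].

End Independence.

Section SJLT.
Context {R : realType} {disp : measure_display} {T : measurableType disp}.
Variable P : probability T R.

Record sjlt_factors (m n s : nat) (sigma delta : 'I_m -> 'I_n -> {RV P >-> R})
    : Prop := SjltFactors {
  sigma_rademacher : forall i j, rademacher P (sigma i j) ;
  sigma_indep : mutually_independent P
    (fun ij : 'I_m * 'I_n => sigma_algebra_of (fun _ : unit => sigma ij.1 ij.2)) ;
  delta_01 : forall i j w, delta i j w = 0 \/ delta i j w = 1 ;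
  sigma_delta_indep : independent2 P
    (sigma_algebra_of (fun ij : 'I_m * 'I_n => sigma ij.1 ij.2))
    (sigma_algebra_of (fun ij : 'I_m * 'I_n => delta ij.1 ij.2)) ;
  delta_column_sparsity : forall j w, #|[set i | delta i j w == 1]%SET| = s ;
  (* the set I stands for the k = #|I| distinct row indices i_1, ..., i_k *)
  delta_moment : forall j (I : {set 'I_m}),
    ('E_P[fun w => (\prod_(i in I) delta i j w)%R]
       <= ((s%:R / m%:R) ^+ #|I|)%:E)%E ;
  delta_columns_indep : mutually_independent P
    (fun j : 'I_n => sigma_algebra_of (fun i : 'I_m => delta i j)) }.

Definition sjlt (m n s : nat) (Phi : T -> 'M[R]_(m, n)) : Prop :=
  exists sigma delta : 'I_m -> 'I_n -> {RV P >-> R},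
    sjlt_factors s sigma delta /\
    forall w i j, Phi w i j = (Num.sqrt s%:R)^-1 * sigma i j w * delta i j w.

End SJLT.

(* Main.v *)
Require Import Defs.
From mathcomp Require Import ring lra zify measurable_realfun.

(** A [C^1] curve in the image of a bi-Lipschitz immersion of the ball lifts to a
    [C^1] curve in the ball, so the tangent hypothesis compares lengths in both
    directions as soon as [Phi] is bi-Lipschitz on the manifold. For chords of
    length at most [1/(4 c0^2 n)] this follows from the tangent hypothesis and
    Taylor's formula, because the Frobenius norm of [Phi] is [sqrt n].

    For longer chords only a crude lower bound on [Phi v] is needed. Scale the
    chord [v] to sup norm 1 and let [N_j] be the number of coordinates of size at
    least [(n+1)^-j]. Either [N_j >= 2^j] and [N_(j+1) < 2^(j+1)] for some [j] with
    [2^j < d], and then [v] rounds to an integer vector with fewer than [2^(j+1)]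
    nonzero coordinates, or [v] has at least [d] coordinates of size
    [n^(-O(log n))], and then a net of the ball is fine enough. At scale [k] the
    union has [exp (O (k (log n)^2))] members. A vector with [k] large coordinates
    is small on all rows with probability at most [2 * 2^-l], where [l] is of order
    [min (s k, m)]: these [k] columns meet more than [l] rows except with
    probability [2^-l], and each row they meet is large for one of the two values
    of a sign. *)

(** * The Euclidean norm on column vectors and the Frobenius bound *)

Section EuclideanNormTheory.
Context {R : realType}.

Lemma l2norm_ge0 n (x : 'cV[R]_n) : 0 <= l2norm x.
Proof. exact: sqrtr_ge0. Qed.

Lemma sqr_l2norm n (x : 'cV[R]_n) : l2norm x ^+ 2 = \sum_i x i 0 ^+ 2.
Proof. by rewrite sqr_sqrtr// sumr_ge0// => i _; exact: sqr_ge0. Qed.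

Lemma l2norm_le n (x : 'cV[R]_n) a :
  0 <= a -> \sum_i x i 0 ^+ 2 <= a ^+ 2 -> l2norm x <= a.
Proof. by move=> a0; rewrite -sqr_l2norm ler_pXn2r// nnegrE ?l2norm_ge0. Qed.

Lemma ler_coord_l2norm n (x : 'cV[R]_n) i : `|x i 0| <= l2norm x.
Proof.
rewrite -sqrtr_sqr /l2norm ler_wsqrtr// (bigD1 i)//= lerDl sumr_ge0// => j _.
exact: sqr_ge0.
Qed.

Lemma l2norm_eq0 n (x : 'cV[R]_n) : (l2norm x == 0) = (x == 0).
Proof.
apply/eqP/eqP => [x0|->].
  apply/colP => i; rewrite mxE; apply/eqP; rewrite -normr_eq0 eq_le normr_ge0.
  by rewrite -x0 ler_coord_l2norm.
by rewrite /l2norm big1 ?sqrtr0// => i _; rewrite mxE expr0n.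
Qed.

Lemma l2norm0 n : l2norm (0 : 'cV[R]_n) = 0.
Proof. by apply/eqP; rewrite l2norm_eq0. Qed.

Lemma l2normZ n a (x : 'cV[R]_n) : l2norm (a *: x) = `|a| * l2norm x.
Proof.
rewrite /l2norm -sqrtr_sqr -sqrtrM ?sqr_ge0// mulr_sumr.
by congr Num.sqrt; apply: eq_bigr => i _; rewrite mxE exprMn.
Qed.

Lemma l2normN n (x : 'cV[R]_n) : l2norm (- x) = l2norm x.
Proof. by rewrite -scaleN1r l2normZ normrN1 mul1r. Qed.

Lemma l2normC n (x y : 'cV[R]_n) : l2norm (x - y) = l2norm (y - x).
Proof. by rewrite -l2normN opprB. Qed.

Lemma l2norm_cauchy_schwarz n (x y : 'cV[R]_n) :
  \sum_i x i 0 * y i 0 <= l2norm x * l2norm y.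
Proof.
have [->|x0] := eqVneq x 0.
  by rewrite l2norm0 mul0r big1// => i _; rewrite mxE mul0r.
have [->|y0] := eqVneq y 0.
  by rewrite l2norm0 mulr0 big1// => i _; rewrite mxE mulr0.
have a0 : 0 < l2norm x by rewrite lt_def l2norm_eq0 x0 l2norm_ge0.
have b0 : 0 < l2norm y by rewrite lt_def l2norm_eq0 y0 l2norm_ge0.
move: (l2norm x) (l2norm y) (sqr_l2norm x) (sqr_l2norm y) a0 b0.
move=> a b ea eb a0 b0; set D := \sum_i _.
have : 0 <= \sum_i (b * x i 0 - a * y i 0) ^+ 2.
  by apply: sumr_ge0 => i _; exact: sqr_ge0.
have -> : \sum_i (b * x i 0 - a * y i 0) ^+ 2 =
    b ^+ 2 * (\sum_i x i 0 ^+ 2) + a ^+ 2 * (\sum_i y i 0 ^+ 2) - 2 * a * b * D.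
  rewrite /D !mulr_sumr -big_split -sumrB.
  by apply: eq_bigr => i _ /=; ring.
rewrite -ea -eb.
have -> : b ^+ 2 * a ^+ 2 + a ^+ 2 * b ^+ 2 - 2 * a * b * D =
  2 * (a * b) * (a * b - D) by ring.
by rewrite pmulr_rge0 ?subr_ge0// mulr_gt0// mulr_gt0.
Qed.

Lemma ler_l2normD n (x y : 'cV[R]_n) : l2norm (x + y) <= l2norm x + l2norm y.
Proof.
apply: l2norm_le; first by rewrite addr_ge0 ?l2norm_ge0.
have -> : \sum_i (x + y) i 0 ^+ 2 =
    l2norm x ^+ 2 + l2norm y ^+ 2 + 2 * \sum_i x i 0 * y i 0.
  rewrite !sqr_l2norm mulr_sumr -!big_split.
  by apply: eq_bigr => i _; rewrite mxE /=; ring.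
have := l2norm_cauchy_schwarz x y; lra.
Qed.

Lemma ler_l2normB n (x y : 'cV[R]_n) : l2norm (x - y) <= l2norm x + l2norm y.
Proof. by rewrite -[l2norm y]l2normN ler_l2normD. Qed.

Lemma lerB_l2dist n (x y : 'cV[R]_n) : l2norm x - l2norm y <= l2norm (x - y).
Proof. by rewrite lerBlDr -{1}(subrK y x) ler_l2normD. Qed.

Lemma ler_dist_l2norm n (x y : 'cV[R]_n) e :
  l2norm (x - y) <= e -> `|l2norm y - l2norm x| <= e.
Proof.
move=> xy; rewrite ler_norml; have := lerB_l2dist x y.
by have := lerB_l2dist y x; rewrite l2normC; lra.
Qed.

Lemma l2norm_le_coord n (x : 'cV[R]_n) a :
  (forall i, `|x i 0| <= a) -> l2norm x <= n%:R * a.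
Proof.
case: n x => [x _|n x h].
  by rewrite mul0r (_ : x = 0) ?l2norm0//; apply/colP => -[].
have a0 : 0 <= a by apply: le_trans (h 0); exact: normr_ge0.
apply: l2norm_le; first by rewrite mulr_ge0.
apply: (@le_trans _ _ (\sum_(i < n.+1) a ^+ 2)).
  by apply: ler_sum => i _; rewrite -real_normK ?num_real// ler_pXn2r// nnegrE.
rewrite sumr_const card_ord exprMn -[leLHS]mulr_natl ler_wpM2r ?sqr_ge0//.
by rewrite -natrX ler_nat expnS expn1 leq_pmulr.
Qed.

Lemma ler_mx_l2norm n (x : 'cV[R]_n) : `|x| <= l2norm x.
Proof.
rewrite /Num.norm/= mx_normrE; apply/bigmax_leP; split; first exact: l2norm_ge0.
by move=> [i j] _ /=; rewrite (ord1 j) ler_coord_l2norm.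
Qed.

Lemma ler_l2norm_mx n (x : 'cV[R]_n) : l2norm x <= n%:R * `|x|.
Proof.
apply: l2norm_le_coord => i; rewrite [leRHS]/Num.norm/= mx_normrE.
by apply: le_trans (le_bigmax _ _ (i, 0)).
Qed.

Definition frob m n (A : 'M[R]_(m, n)) : R :=
  Num.sqrt (\sum_i \sum_j A i j ^+ 2).

Lemma frob_ge0 m n (A : 'M[R]_(m, n)) : 0 <= frob A.
Proof. exact: sqrtr_ge0. Qed.

(** Cauchy-Schwarz on each row; the lower bound for a coordinate of [A *m v] is the upper bound for
    [- v]. *)
Lemma l2norm_mulmx m n (A : 'M[R]_(m, n)) v :
  l2norm (A *m v) <= frob A * l2norm v.
Proof.
apply: l2norm_le; first by rewrite mulr_ge0 ?l2norm_ge0 ?frob_ge0.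
rewrite exprMn sqr_sqrtr; last first.
  by apply: sumr_ge0 => i _; apply: sumr_ge0 => j _; exact: sqr_ge0.
rewrite mulr_suml; apply: ler_sum => i _.
pose r : 'cV[R]_n := \col_j A i j.
have rv w : (A *m w) i 0 = \sum_j r j 0 * w j 0.
  by rewrite mxE; apply: eq_bigr => j _; rewrite mxE.
have -> : \sum_j A i j ^+ 2 = l2norm r ^+ 2.
  by rewrite sqr_l2norm; apply: eq_bigr => j _; rewrite mxE.
rewrite -exprMn -(real_normK (num_real _)) ler_pXn2r ?nnegrE ?normr_ge0//; last first.
  by rewrite mulr_ge0 ?l2norm_ge0.
rewrite ler_norml rv l2norm_cauchy_schwarz andbT lerNl -rv.
have -> : - (A *m v) i 0 = (A *m - v) i 0 by rewrite mulmxN [RHS]mxE.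
by rewrite rv (le_trans (l2norm_cauchy_schwarz _ _))// l2normN.
Qed.

End EuclideanNormTheory.

(** * Continuously differentiable curves on the closed unit interval *)

Section CurvesOnUnitInterval.
Context {R : realType}.
Notation I01 := (@unit_itv R).

Lemma unit_itvP (t : R) : I01 t <-> 0 <= t <= 1.
Proof. by rewrite /unit_itv/= in_itv. Qed.

(** First-order expansions in the Euclidean norm can be added, multiplied by matrices and restricted
    to a subset, which is how all later derivatives are computed. *)
Lemma derivable_nearP n (g : R -> 'cV[R]_n) (t : R) (D : 'cV[R]_n) :
  is_derive t (1 : R) g D <->
  forall e, 0 < e ->
    \forall r \near t, l2norm (g r - g t - (r - t) *: D) <= e * `|r - t|.
Proof.
pose q h := h^-1 *: ((g \o shift t) (h *: 1) - g t).
have qE h : h != 0 -> h *: (D - q h) = - (g (t + h) - g t - h *: D).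
  move=> h0; rewrite /q /= scalerBr scalerA mulfV// scale1r.
  by rewrite [_%:A]mulr1 [h + t]addrC !opprB.
suff H : q @ 0^' --> D <-> forall e, 0 < e ->
    \forall r \near t, l2norm (g r - g t - (r - t) *: D) <= e * `|r - t|.
  split=> [[dg dD]|/H qD]; last by split; [apply/cvg_ex; exists D|exact: cvg_lim].
  by apply/H; rewrite -dD; exact: dg.
split=> [/cvgrPdist_le qD e e0|h].
  (* Passing from the sup norm to the Euclidean one costs a factor [n]; the divisor [n.+1] stays
     nonzero when [n = 0]. *)
  apply/nbhs0P; have e1 : 0 < e / n.+1%:R by rewrite divr_gt0.
  have := qD _ e1; rewrite near_withinE; apply: filterS => h /= hD.
  rewrite (addrC t) addrK; have [->|h0] := eqVneq h 0.
    by rewrite add0r subrr scale0r subrr l2norm0 normr0 mulr0.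
  have := hD h0 => {}hD; rewrite -(addrC t) -l2normN -qE// l2normZ mulrC.
  rewrite ler_wpM2r// (le_trans (ler_l2norm_mx _))//.
  rewrite (le_trans (ler_wpM2l _ hD))// mulrCA (ler_piMr (ltW e0))//.
  by rewrite ler_pdivrMr ?ltr0Sn// mul1r ler_nat.
apply/cvgrPdist_le => e e0; rewrite near_withinE.
have /nbhs0P := h _ e0; apply: filterS => r /= + r0.
rewrite (addrC t) addrK -(addrC t) -l2normN -qE// l2normZ mulrC.
by rewrite ler_pM2r ?normr_gt0// => /(le_trans (ler_mx_l2norm _)).
Qed.

Lemma cv_continuous_nearP n (g : R -> 'cV[R]_n) (t : R) :
  {for t, continuous g} <->
  forall e, 0 < e -> \forall r \near t, l2norm (g r - g t) <= e.
Proof.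
split=> [/cvgrPdist_le h e e0|h].
  have e1 : 0 < e / n.+1%:R by rewrite divr_gt0.
  apply: filterS (h _ e1) => r hr.
  rewrite l2normC (le_trans (ler_l2norm_mx _))//.
  rewrite (le_trans (ler_wpM2l _ hr))// mulrCA (ler_piMr (ltW e0))//.
  by rewrite ler_pdivrMr ?ltr0Sn// mul1r ler_nat.
apply/cvgrPdist_le => e e0; apply: filterS (h _ e0) => r hr.
by rewrite (le_trans (ler_mx_l2norm _))// l2normC.
Qed.

(* [g] is continuously differentiable on [0, 1] with derivative [g'], where
   the derivatives at the endpoints are one-sided. *)
Definition C1_pair n (g g' : R -> 'cV[R]_n) : Prop :=
  forall t, I01 t -> forall e, 0 < e -> \forall r \near within I01 (nbhs t),
    l2norm (g r - g t - (r - t) *: g' t) <= e * `|r - t| /\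
    l2norm (g' r - g' t) <= e.

(** The factor [Q] may depend on [t] but not on [e], so running the hypothesis with [e / (|Q| + 1)]
    absorbs it. *)
Lemma C1_pairI n (g g' : R -> 'cV[R]_n) :
  (forall t, I01 t -> exists Q, forall e, 0 < e ->
    \forall r \near within I01 (nbhs t),
    l2norm (g r - g t - (r - t) *: g' t) <= Q * e * `|r - t| /\
    l2norm (g' r - g' t) <= Q * e) -> C1_pair g g'.
Proof.
move=> h t It e e0; have [Q hQ] := h t It.
have Q1 : 0 < `|Q| + 1 by rewrite ltr_wpDl.
have e1 : 0 < e / (`|Q| + 1) by rewrite divr_gt0.
have QE : Q * (e / (`|Q| + 1)) <= e.
  rewrite mulrCA (ler_piMr (ltW e0))// ler_pdivrMr// mul1r.
  by rewrite (le_trans (ler_norm _))// lerDl.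
apply: filterS (hQ _ e1) => r [h1 h2]; split; last exact: le_trans QE.
by rewrite (le_trans h1)// ler_wpM2r.
Qed.

Lemma near_within_dist (t e : R) : 0 < e ->
  \forall r \near within I01 (nbhs t), `|r - t| <= e.
Proof.
move=> e0; rewrite near_withinE; near=> r => _; rewrite distrC.
by near: r; exact: cvgr_dist_le.
Unshelve. all: by end_near. Qed.

Lemma C1_on_pair n (g : R -> 'cV[R]_n) : C1_on I01 g -> C1_pair g (derive1 g).
Proof.
move=> [U [oU IU [dg cg]]] t It e e0.
have Ut : U t by apply: IU.
have /derivableP/derivable_nearP h1 : derivable g t 1.
  by apply: diff_derivable; exact: dg.
have h2 := (cv_continuous_nearP _ _).1 (cg 1 t Ut).
rewrite near_withinE; apply: filterS2 (h1 e e0) (h2 e e0) => r a b _.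
by rewrite !derive1E.
Qed.

(** The nearest-point projection onto the unit interval. *)
Let clamp (t : R) : R := Num.max 0 (Num.min t 1).

Let clamp_id t : I01 t -> clamp t = t.
Proof.
by move=> /unit_itvP/andP[t0 t1]; rewrite /clamp (min_idPl t1) (max_idPr t0).
Qed.

Let clamp01 t : I01 (clamp t).
Proof.
by apply/unit_itvP; rewrite /clamp le_max lexx/= ge_max ler01/= ge_min lexx orbT.
Qed.

Let clamp_dist t r : I01 t ->
  `|clamp r - t| <= `|r - t| /\ `|r - clamp r| <= `|r - t|.
Proof.
move=> /unit_itvP t01; rewrite /clamp.
have [?|?] := leP r 1; [have [?|?] := leP 0 r|have [?|?] := leP (0 : R) 1];
  by rewrite !ler_norml; case: (ger0P (r - t)) => ?; lra.
Qed.

Let near_clamp t : ~ I01 t -> \forall r \near t, clamp r = clamp t.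
Proof.
move=> nt; have [t0|t0] := ltP t 0.
  near=> r; have r0 : r < 0 by near: r; exact: lt_nbhsl.
  rewrite /clamp (min_idPl _); last lra. rewrite (min_idPl _); last lra.
  by rewrite !max_l// ltW.
have [t1|t1] := ltP 1 t; last by case: nt; apply/unit_itvP; lra.
near=> r; have r1 : 1 < r by near: r; exact: lt_nbhsr.
by rewrite /clamp (min_idPr _) ?ltW// (min_idPr _) ?ltW.
Unshelve. all: by end_near. Qed.

(** [C1_on] asks for regularity on an open neighbourhood, while lifted curves only have one-sided
    derivatives at the ends. Continuing the curve along its two end tangents gives a curve on the
    whole line with continuous derivative [g' \o clamp]. *)
Lemma C1_pair_extend n (g g' : R -> 'cV[R]_n) : C1_pair g g' ->
  exists gx, C1_on I01 gx /\
    forall t, I01 t -> gx t = g t /\ derive1 gx t = g' t.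
Proof.
move=> gg'.
pose gx (t : R) : 'cV[R]_n := g (clamp t) + (t - clamp t) *: g' (clamp t).
(* Since [clamp r] is no farther from [t] than [r], estimates within the interval become estimates
   on a full neighbourhood. *)
have cvg' t : I01 t -> forall e, 0 < e -> \forall r \near t,
    l2norm (g (clamp r) - g t - (clamp r - t) *: g' t) <= e * `|r - t| /\
    l2norm (g' (clamp r) - g' t) <= e.
  move=> It e e0; have := gg' t It e e0.
  rewrite near_withinE => /nbhs_ballP[/= del del0 h].
  apply/nbhs_ballP; exists del => //= r; rewrite /ball/= distrC => rt.
  have [h1 _] := @clamp_dist t r It.
  have [] := h (clamp r).
  - by rewrite /ball/= distrC (le_lt_trans h1).
  - exact: clamp01.
  by move=> a b; split => //; rewrite (le_trans a)// ler_wpM2l// ltW.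
have dgx (t : R) : is_derive t (1 : R) gx (g' (clamp t)).
  apply/derivable_nearP => e e0; have [It|nIt] := pselect (I01 t).
    rewrite (clamp_id It); have e2 : 0 < e / 2 by rewrite divr_gt0.
    apply: filterS (cvg' t It _ e2) => r [a b].
    have [_ h2] := @clamp_dist t r It.
    have -> : gx r - gx t - (r - t) *: g' t =
        (g (clamp r) - g t - (clamp r - t) *: g' t) +
        (r - clamp r) *: (g' (clamp r) - g' t).
      by rewrite /gx (clamp_id It) subrr scale0r; apply/colP => i; rewrite !mxE; ring.
    rewrite (le_trans (ler_l2normD _ _))// l2normZ.
    have : `|r - clamp r| * l2norm (g' (clamp r) - g' t) <= `|r - t| * (e / 2).
      by apply: ler_pM => //; exact: l2norm_ge0.
    lra.
  apply: filterS (near_clamp nIt) => r rt.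
  have -> : gx r - gx t - (r - t) *: g' (clamp t) = 0.
    by rewrite /gx rt; apply/colP => i; rewrite !mxE; ring.
  by rewrite l2norm0 mulr_ge0// ltW.
have dE : derive1 gx = g' \o clamp.
  by apply/funext => t; rewrite derive1E; have [_ ->] := dgx t.
exists gx; split; last first.
  move=> t It; rewrite dE /= /gx (clamp_id It) subrr scale0r addr0; split => //.
exists setT; split => //; first exact: openT.
have dif t : differentiable gx t by apply/derivable1_diffP; have [] := dgx t.
split=> [t _|v]; first exact: dif.
have -> : 'D_v gx = (fun t => v *: derive1 gx t).
  by apply/funext => t; rewrite deriveE// diff1E.
move=> t _; apply: continuousZl_tmp.
rewrite dE; apply/cv_continuous_nearP => e e0 /=.
have [It|nIt] := pselect (I01 t).
  by rewrite (clamp_id It); apply: filterS (cvg' t It _ e0) => r [].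
by apply: filterS (near_clamp nIt) => r ->; rewrite subrr l2norm0 ltW.
Qed.

End CurvesOnUnitInterval.

(** * Pushing curves forward and lifting them through an expansive map *)

Section LiftingCurves.
Context {R : realType}.
Notation I01 := (@unit_itv R).

(** A matrix bounded below has trivial kernel, so its transpose has full row rank. *)
Lemma expansive_left_inverse d m (A : 'M[R]_(m, d)) c : 0 < c ->
  (forall w, c * l2norm w <= l2norm (A *m w)) ->
  (d <= m)%N /\ exists L : 'M[R]_(d, m), L *m A = 1%:M.
Proof.
move=> c0 cA.
have fA : row_free A^T.
  rewrite -kermx_eq0; apply/rowV0P => v /sub_kermxP vA.
  apply: trmx_inj; apply/eqP; rewrite trmx0 -l2norm_eq0 eq_le l2norm_ge0 andbT.
  rewrite -(pmulr_rle0 _ c0) (le_trans (cA _))//.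
  by rewrite -[A]trmxK -trmx_mul vA trmx0 l2norm0.
have [B AB] := row_freeP fA; split.
  by rewrite -(eqP fA : \rank A^T = d) rank_leq_col.
by exists B^T; apply: trmx_inj; rewrite trmx_mul trmxK AB trmx1.
Qed.

Let near_conj (t : R) (P Q : R -> Prop) :
  (\forall x \near within I01 (nbhs t), P x) ->
  (\forall x \near within I01 (nbhs t), Q x) ->
  \forall x \near within I01 (nbhs t), P x /\ Q x.
Proof. exact: filterI. Qed.

Variables (d m : nat) (G : 'cV[R]_d -> 'cV[R]_m) (A : 'cV[R]_d -> 'M[R]_(m, d)).
Variables (B : set 'cV[R]_d) (K : R).
Hypothesis K0 : 0 <= K.
Hypothesis taylorG : forall x y, B x -> B y ->
  l2norm (G y - G x - A x *m (y - x)) <= K * l2norm (y - x) ^+ 2.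
Hypothesis lipA : forall x y, B x -> B y -> forall v,
  l2norm ((A x - A y) *m v) <= K * l2norm (x - y) * l2norm v.

Lemma C1_pair_near_lipschitz n (u w : R -> 'cV[R]_n) t e : C1_pair u w ->
  I01 t -> 0 < e -> \forall r \near within I01 (nbhs t),
    l2norm (u r - u t) <= (e + l2norm (w t)) * `|r - t|.
Proof.
move=> uw It e0; apply: filterS (uw t It e e0) => r [h _].
rewrite -(subrK ((r - t) *: w t) (u r - u t)) (le_trans (ler_l2normD _ _))//.
by rewrite mulrDl l2normZ [_ * `|_|]mulrC [leRHS]addrC [leRHS]addrC lerD// mulrC.
Qed.

(** The chain rule on a set [B] that need not be open: [A] stands for the derivative of [G] only
    through the quadratic Taylor remainder and the Lipschitz bound. *)
Lemma C1_pair_push (u w : R -> 'cV[R]_d) : C1_pair u w ->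
  (forall t, I01 t -> B (u t)) ->
  C1_pair (G \o u) (fun t => A (u t) *m w t).
Proof.
move=> uw Bu; apply: C1_pairI => t It.
pose M := 1 + l2norm (w t).
have M0 : 0 <= M by rewrite addr_ge0 ?l2norm_ge0.
pose f := frob (A (u t)); have f0 : 0 <= f := frob_ge0 _.
exists (K * M * M + f + (K * M + K * M * l2norm (w t))) => e e0.
have H1 := @C1_pair_near_lipschitz _ u w t 1 uw It (@ltr01 R).
have H2 : \forall r \near within I01 (nbhs t), I01 r by exact: withinT.
have H3 := near_conj (near_within_dist t (@ltr01 R)) (near_within_dist t e0).
move: (near_conj (near_conj (near_conj H1 H2) (uw t It e e0)) H3).
apply: filterS => r [[[h3 Ir] [h1 h2]] [h4 h5]] /=; rewrite -/M in h3.
set a := `|r - t| in h1 h3 h4 h5 *.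
have a0 : 0 <= a by exact: normr_ge0.
have du0 := l2norm_ge0 (u r - u t).
have Br := Bu _ Ir; have Bt := Bu _ It.
split.
  have -> : G (u r) - G (u t) - (r - t) *: (A (u t) *m w t) =
    (G (u r) - G (u t) - A (u t) *m (u r - u t)) +
    A (u t) *m (u r - u t - (r - t) *: w t).
    rewrite [X in _ = _ + X]mulmxBr -scalemxAr.
    by apply/colP => i; rewrite !mxE; ring.
  rewrite (le_trans (ler_l2normD _ _))//.
  have t1 := taylorG Bt Br.
  have t2 : l2norm (u r - u t) ^+ 2 <= M * M * (e * a).
    rewrite (le_trans (y := (M * a) ^+ 2))//.
      by rewrite ler_pXn2r ?nnegrE// mulr_ge0.
    rewrite exprMn -expr2 ler_wpM2l ?sqr_ge0// expr2 ler_wpM2r//.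
  have t3 : l2norm (A (u t) *m (u r - u t - (r - t) *: w t)) <= f * (e * a).
    by rewrite (le_trans (l2norm_mulmx _ _))// ler_wpM2l.
  have t4 := ler_wpM2l K0 t2.
  rewrite (le_trans (lerD t1 t3))// (le_trans (lerD t4 (lexx _)))//.
  have -> : K * (M * M * (e * a)) + f * (e * a) = (K * M * M + f) * e * a by ring.
  rewrite ler_wpM2r// (ler_wpM2r (ltW e0))// lerDl.
  by rewrite addr_ge0 ?mulr_ge0 ?l2norm_ge0.
have -> : A (u r) *m w r - A (u t) *m w t =
    A (u t) *m (w r - w t) + ((A (u r) - A (u t)) *m (w r - w t) +
    (A (u r) - A (u t)) *m w t).
  by rewrite !mulmxBr !mulmxBl; apply/colP => i; rewrite !mxE; ring.
rewrite (le_trans (ler_l2normD _ _))//.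
have t1 : l2norm (A (u t) *m (w r - w t)) <= f * e.
  by rewrite (le_trans (l2norm_mulmx _ _))// ler_wpM2l.
have t2 := le_trans (ler_l2normD ((A (u r) - A (u t)) *m (w r - w t)) _)
  (lerD (lexx _) (lipA Br Bt (w t))).
have t3 := lipA Br Bt (w r - w t).
have t4 : K * l2norm (u r - u t) * l2norm (w r - w t) <= K * M * e.
  rewrite -!mulrA ler_wpM2l//; apply: ler_pM => //; first exact: l2norm_ge0.
  by rewrite (le_trans h3)// ler_piMr.
have t5 : K * l2norm (u r - u t) * l2norm (w t) <= K * M * l2norm (w t) * e.
  have -> : K * M * l2norm (w t) * e = K * (M * e) * l2norm (w t) by ring.
  rewrite ler_wpM2r ?l2norm_ge0// ler_wpM2l// (le_trans h3)// ler_wpM2l//.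
have : 0 <= K * M * M * e by rewrite !mulr_ge0// ltW.
lra.
Qed.

Variable c : R.
Hypothesis c_gt0 : 0 < c.
Hypothesis expG : forall x y, B x -> B y ->
  c * l2norm (x - y) <= l2norm (G x - G y).
Hypothesis expA : forall x, B x -> forall w, c * l2norm w <= l2norm (A x *m w).

(** The lift [u] is the pointwise preimage, and expansivity of [G] makes it Lipschitz near each [t].
    Taylor's formula then gives [A (u t) *m (u r - u t)] equal to [(r - t) *: h' t] up to a small
    multiple of [|r - t|], and a left inverse of [A (u t)] extracts the derivative of [u]. *)
Lemma C1_pair_lift (h h' : R -> 'cV[R]_m) : C1_pair h h' ->
  (forall t, I01 t -> (G @` B) (h t)) ->
  exists u w, C1_pair u w /\ forall t, I01 t ->
    [/\ B (u t), G (u t) = h t & A (u t) *m w t = h' t].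
Proof.
move=> hh' hB.
have /choice[u uP] : forall t, exists x, I01 t -> B x /\ G x = h t.
  move=> t; have [It|nIt] := pselect (I01 t); last by exists 0.
  by have [x Bx xh] := hB t It; exists x.
have /choice[L LP] : forall t, exists L, I01 t -> L *m A (u t) = 1%:M.
  move=> t; have [It|nIt] := pselect (I01 t); last by exists 0.
  have [_ [L hL]] := expansive_left_inverse c_gt0 (expA (uP t It).1).
  by exists L.
(* [L] is chosen separately at each [t] with no continuity in [t]; continuity of [w] is recovered at
   the end from [expA]. *)
pose w t := L t *m h' t.
have Bu t : I01 t -> B (u t) by move=> /uP[].
have Gu t : I01 t -> G (u t) = h t by move=> /uP[].
pose M t := (1 + l2norm (h' t)) / c.
have M0 t : 0 <= M t by rewrite divr_ge0 ?addr_ge0 ?l2norm_ge0// ltW.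
have lipu t : I01 t -> \forall r \near within I01 (nbhs t),
    l2norm (u r - u t) <= M t * `|r - t|.
  move=> It; have H1 := @C1_pair_near_lipschitz _ h h' t 1 hh' It (@ltr01 R).
  have H2 : \forall r \near within I01 (nbhs t), I01 r by exact: withinT.
  apply: filterS2 H1 H2 => r h1 Ir.
  rewrite /M mulrAC ler_pdivlMr// mulrC (le_trans (expG (Bu _ Ir) (Bu _ It)))//.
  by rewrite !Gu.
clearbody M.
have main t : I01 t -> forall e, 0 < e -> \forall r \near within I01 (nbhs t),
    l2norm (A (u t) *m (u r - u t) - (r - t) *: h' t) <=
      (1 + K * M t * M t) * e * `|r - t|.
  move=> It e e0.
  have H2 : \forall r \near within I01 (nbhs t), I01 r by exact: withinT.
  have H3 := near_conj (near_within_dist t e0) H2.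
  move: (near_conj (near_conj (hh' t It e e0) (lipu t It)) H3).
  apply: filterS => r [[[h1 _] h2] [h3 Ir]].
  have := taylorG (Bu _ It) (Bu _ Ir); rewrite !Gu// => h4.
  have -> : A (u t) *m (u r - u t) - (r - t) *: h' t =
    (h r - h t - (r - t) *: h' t) - (h r - h t - A (u t) *m (u r - u t)).
    by apply/colP => i; rewrite !mxE; ring.
  rewrite (le_trans (ler_l2normB _ _))// (le_trans (lerD h1 h4))//.
  have h5 : l2norm (u r - u t) ^+ 2 <= M t * M t * (e * `|r - t|).
    rewrite (le_trans (y := (M t * `|r - t|) ^+ 2))//.
      rewrite ler_pXn2r ?nnegrE ?l2norm_ge0 //; first exact: mulr_ge0.
    by rewrite exprMn -expr2 ler_wpM2l ?sqr_ge0// expr2 ler_wpM2r.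
  rewrite (le_trans (lerD (lexx _) (ler_wpM2l K0 h5)))//.
  by rewrite le_eqVlt; apply/orP; left; apply/eqP; ring.
have du t : I01 t -> exists Q, forall e, 0 < e ->
    \forall r \near within I01 (nbhs t),
    l2norm (u r - u t - (r - t) *: w t) <= Q * e * `|r - t|.
  move=> It; exists (frob (L t) * (1 + K * M t * M t)) => e e0.
  apply: filterS (main t It e e0) => r h1.
  have -> : u r - u t - (r - t) *: w t =
    L t *m (A (u t) *m (u r - u t) - (r - t) *: h' t).
    by rewrite mulmxBr mulmxA LP// mul1mx -scalemxAr.
  apply: le_trans (l2norm_mulmx _ _) _.
  by have := ler_wpM2l (frob_ge0 (L t)) h1; rewrite !mulrA.
(* A left inverse does not show that [h' t] is in the range of [A (u t)]. That follows by comparing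
   the two expansions of [A (u t) *m (u r - u t)] at some [r] different from [t] and dividing by
   [|r - t|]. *)
have Aw t : I01 t -> A (u t) *m w t = h' t.
  move=> It; have [Q hQ] := du t It.
  apply/eqP; rewrite -subr_eq0 -l2norm_eq0 eq_le l2norm_ge0 andbT.
  pose Q' := frob (A (u t)) * `|Q| + (1 + K * M t * M t).
  have Q'0 : 0 < Q'.
    by rewrite ltr_wpDl ?mulr_ge0 ?frob_ge0// ltr_pwDl// !mulr_ge0.
  apply/ler_addgt0Pl => e e0; rewrite addr0.
  have e1 : 0 < e / Q' by rewrite divr_gt0.
  have := near_conj (hQ _ e1) (main t It _ e1); rewrite near_withinE.
  move=> /nbhs_ballP[/= del del0 hdel].
  (* Moving from [t] towards the far half of the interval by at most [1 / 2] stays inside it. *)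
  have [r [Ir rt rdel]] : exists r, [/\ I01 r, r != t & `|r - t| < del].
    pose z := Num.min (del / 2) (1 / 2).
    have z0 : 0 < z by rewrite lt_min; apply/andP; split; lra.
    have z1 : z <= 1 / 2 by rewrite ge_min lexx orbT.
    have z2 : z < del by rewrite gt_min; apply/orP; left; lra.
    move/unit_itvP : It => It; have [t2|t2] := leP t (1 / 2).
      exists (t + z); split; first (by apply/unit_itvP; lra).
        by rewrite gt_eqF// ltrDl.
      by rewrite [t + z]addrC addrK gtr0_norm.
    exists (t - z); split; first (by apply/unit_itvP; lra).
      by rewrite lt_eqF// gtrBl.
    by rewrite addrC addKr normrN gtr0_norm.
  have [||h1 h2] := hdel r; [by rewrite /ball/= distrC|exact: Ir|].
  have rt0 : 0 < `|r - t| by rewrite normr_gt0 subr_eq0.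
  rewrite -(ler_pM2l rt0) -l2normZ.
  have -> : (r - t) *: (A (u t) *m w t - h' t) =
      (A (u t) *m (u r - u t) - (r - t) *: h' t) -
      A (u t) *m (u r - u t - (r - t) *: w t).
    rewrite [X in _ = _ - X]mulmxBr -scalemxAr.
    by apply/colP => i; rewrite !mxE; ring.
  rewrite (le_trans (ler_l2normB _ _))//.
  rewrite (le_trans (lerD h2 (l2norm_mulmx _ _)))//.
  rewrite (le_trans (lerD (lexx _) (ler_wpM2l (frob_ge0 _) h1)))//.
  apply: (@le_trans _ _ (`|r - t| * (Q' * (e / Q')))); last first.
    by rewrite [Q' * _]mulrC divfK ?gt_eqF.
  have -> : `|r - t| * (Q' * (e / Q')) = (1 + K * M t * M t) * (e / Q') * `|r - t|
    + frob (A (u t)) * (`|Q| * (e / Q') * `|r - t|).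
    by move: (e / Q'); rewrite /Q' => x; ring.
  rewrite lerD2l ler_wpM2l ?frob_ge0// ler_wpM2r// ler_wpM2r ?ler_norm//.
  exact: ltW.
exists u, w; split; last by move=> t It; split; [exact: Bu|exact: Gu|exact: Aw].
apply: C1_pairI => t It; have [Q hQ] := du t It.
pose Q2 := (1 + K * M t * l2norm (w t)) / c.
have Q20 : 0 <= Q2.
  by apply: divr_ge0; [rewrite addr_ge0// !mulr_ge0// l2norm_ge0|exact: ltW].
exists (`|Q| + Q2) => e e0.
have H2 : \forall r \near within I01 (nbhs t), I01 r by exact: withinT.
have H3 := near_conj (near_within_dist t e0) H2.
move: (near_conj (hQ e e0) (near_conj (near_conj (hh' t It e e0) (lipu t It)) H3)).
apply: filterS => r [h1 [[[_ h2] h3] [h4 Ir]]]; split.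
  rewrite (le_trans h1)// ler_wpM2r// (ler_wpM2r (ltW e0))// (le_trans (ler_norm _))//.
  by rewrite lerDl.
apply: (@le_trans _ _ (Q2 * e)); last by rewrite (ler_wpM2r (ltW e0))// lerDr.
(* The increment of [w] is bounded through its image under [A (u r)], where [A w = h'] reduces it to
   the increments of [h'] and [A]. *)
rewrite /Q2 mulrAC ler_pdivlMr// mulrC (le_trans (expA (Bu _ Ir) _))//.
have -> : A (u r) *m (w r - w t) =
    (h' r - h' t) - (A (u r) - A (u t)) *m w t.
  by rewrite mulmxBr mulmxBl !Aw//; apply/colP => i; rewrite !mxE; ring.
rewrite (le_trans (ler_l2normB _ _))//.
rewrite (le_trans (lerD h2 (lipA (Bu _ Ir) (Bu _ It) _)))//.
rewrite mulrDl mul1r lerD2l.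
have -> : K * M t * l2norm (w t) * e = K * (M t * e) * l2norm (w t) by ring.
by rewrite ler_wpM2r ?l2norm_ge0// ler_wpM2l// (le_trans h3)// ler_wpM2l.
Qed.

End LiftingCurves.

(** * Jacobian, Taylor's formula and the expansivity of the differential on the ball *)

Section Differential.
Context {R : realType}.

Definition jac d n (F : 'cV[R]_d -> 'cV[R]_n) (x : 'cV[R]_d) : 'M[R]_(n, d) :=
  \matrix_(i, j) 'd F x (delta_mx j 0) i 0.

Lemma diff_jac d n (F : 'cV[R]_d -> 'cV[R]_n) x v : 'd F x v = jac F x *m v.
Proof.
rewrite {1}(matrix_sum_delta v) linear_sum/=; apply/colP => i.
rewrite summxE !mxE; apply: eq_bigr => j _.
by rewrite big_ord1 linearZ/= !mxE mulrC.
Qed.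

Lemma l2opnorm_mulmx d n (A : 'M[R]_(n, d)) v :
  l2norm (A *m v) <= l2opnorm (mulmx A) * l2norm v.
Proof.
have [->|v0] := eqVneq v 0; first by rewrite mulmx0 !l2norm0 mulr0.
have nv : 0 < l2norm v by rewrite lt_def l2norm_eq0 v0 l2norm_ge0.
rewrite -ler_pdivrMr//.
have -> : l2norm (A *m v) / l2norm v = l2norm (A *m ((l2norm v)^-1 *: v)).
  by rewrite -scalemxAr l2normZ ger0_norm ?invr_ge0 ?l2norm_ge0// mulrC.
apply: ub_le_sup.
  exists (frob A) => _ [w w1 <-]; rewrite (le_trans (l2norm_mulmx _ _))//.
  by rewrite ler_piMr ?frob_ge0.
exists ((l2norm v)^-1 *: v) => //; rewrite /l2ball/= l2normZ.
by rewrite ger0_norm ?invr_ge0 ?l2norm_ge0// mulVf// gt_eqF.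
Qed.

Lemma l2ball_segment d (x y : 'cV[R]_d) t : l2ball R d x -> l2ball R d y ->
  0 <= t <= 1 -> l2ball R d (x + t *: (y - x)).
Proof.
rewrite /l2ball/= => x1 y1 t01.
have -> : x + t *: (y - x) = (1 - t) *: x + t *: y.
  by apply/colP => i; rewrite !mxE; ring.
rewrite (le_trans (ler_l2normD _ _))// !l2normZ !ger0_norm; [|lra|lra].
have : (1 - t) * l2norm x <= (1 - t) * 1 by apply: ler_wpM2l => //; lra.
have : t * l2norm y <= t * 1 by apply: ler_wpM2l => //; lra.
lra.
Qed.

Lemma is_derive_segment d n (F : 'cV[R]_d -> 'cV[R]_n) x v (t : R) :
  differentiable F (x + t *: v) ->
  is_derive t (1 : R) (fun s : R => F (x + s *: v)) (jac F (x + t *: v) *m v).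
Proof.
move=> dF.
have h : is_diff t (fun s : R => x + s *: v) (fun s => 0 + s *: v).
  exact: is_diffD.
have := is_diff_comp h (differentiableP dF).
move=> [df dfE].
split; first by apply: diff_derivable.
by rewrite deriveE// dfE /= add0r scale1r diff_jac.
Qed.

Variables (d n : nat) (F : 'cV[R]_d -> 'cV[R]_n) (c0 : R).
Notation B := (l2ball R d).
Hypothesis c0_ge1 : 1 <= c0.
Hypothesis smoothF : smooth_on B F.
Hypothesis bilipF : forall x y, B x -> B y ->
  c0^-1 * l2norm (x - y) <= l2norm (F x - F y) <= c0 * l2norm (x - y).
Hypothesis lipdF : forall x y, B x -> B y ->
  l2opnorm (fun v => 'd F x v - 'd F y v) <= c0 * l2norm (x - y).

Lemma jac_lipschitz x y v : B x -> B y ->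
  l2norm ((jac F x - jac F y) *m v) <= c0 * l2norm (x - y) * l2norm v.
Proof.
move=> Bx By; rewrite (le_trans (l2opnorm_mulmx _ _))//.
have fE : (fun w => 'd F x w - 'd F y w) = mulmx (jac F x - jac F y).
  apply/funext => w.
  have h := congr2 (fun a b : 'cV[R]_n => a - b) (diff_jac F x w) (diff_jac F y w).
  exact: etrans h (esym (mulmxBl _ _ _)).
by rewrite ler_wpM2r ?l2norm_ge0// -fE; exact: lipdF.
Qed.

(** The mean value theorem is scalar, so it is applied to the inner product of the remainder [e]
    itself with [F (x + t *: v) - t *: (jac F x *m v)]. The increment over the unit interval is
    [l2norm e ^+ 2], and Cauchy-Schwarz bounds the derivative by [l2norm e] times the wanted
    bound. *)
Lemma taylor_l2ball x y : B x -> B y ->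
  l2norm (F y - F x - jac F x *m (y - x)) <= c0 * l2norm (y - x) ^+ 2.
Proof.
move=> Bx By; set v := y - x; set e := F y - _ - _.
have [U [oU BU CU]] := smoothF.
have dF z : B z -> differentiable F z.
  by move=> /BU Uz; have [+ _] := CU 1%N; apply.
pose f (t : R) := \sum_i e i 0 * (F (x + t *: v) i 0 - t * (jac F x *m v) i 0).
pose df (t : R) := \sum_i e i 0 * ((jac F (x + t *: v) *m v) i 0 - (jac F x *m v) i 0).
have fD (t : R) : 0 <= t <= 1 -> is_derive t (1 : R) f (df t).
  move=> t01.
  have [dg gE] := is_derive_segment (dF _ (l2ball_segment Bx By t01)).
  have h i : is_derive t (1 : R) (fun s : R => F (x + s *: v) i 0)
      ((jac F (x + t *: v) *m v) i 0).
    split; first by have /derivable_mxP := dg; apply.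
    by rewrite -gE derive_mx// mxE.
  have -> : f = \sum_i (e i 0 *: ((fun s : R => F (x + s *: v) i 0) -
      (fun s : R => s * (jac F x *m v) i 0))).
    by apply/funext => s; rewrite /f fct_sumE; apply: eq_bigr => i _.
  apply: is_derive_sum => i.
  apply: is_deriveZ; apply: is_deriveB.
  rewrite -[X in is_derive _ _ _ X]mulr1.
  have -> : (fun s : R => s * (jac F x *m v) i 0) =
    (jac F x *m v) i 0 *: (id : R -> R).
    by apply/funext => s; rewrite mulrC.
  exact: is_deriveZ.
have [] := @MVT R f df 0 1 ltr01.
- by move=> t; rewrite in_itv/= => /andP[t0 t1]; apply: fD; rewrite !ltW.
- apply: derivable_within_continuous => t; rewrite in_itv/= => t01.
  by have [] := fD t t01.
move=> t; rewrite in_itv/= subr0 mulr1 => /andP[t0 t1] fE.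
have {}fE : l2norm e ^+ 2 = df t.
  rewrite -fE sqr_l2norm /f -sumrB; apply: eq_bigr => i _.
  rewrite scale1r scale0r addr0 (_ : x + v = y); last by rewrite addrC subrK.
  by rewrite expr2 {2}/e !mxE; ring.
have : df t <= l2norm e * (c0 * l2norm v ^+ 2).
  have -> : df t = \sum_i e i 0 * ((jac F (x + t *: v) - jac F x) *m v) i 0.
    have mxB (P Q : 'cV[R]_n) i : (P - Q) i 0 = P i 0 - Q i 0 by rewrite !mxE.
    by apply: eq_bigr => i _; rewrite mulmxBl (mxB (jac F _ *m v)).
  rewrite (le_trans (l2norm_cauchy_schwarz _ _))// ler_wpM2l ?l2norm_ge0//.
  have t01 : 0 <= t <= 1 by rewrite !ltW.
  rewrite (le_trans (jac_lipschitz _ (l2ball_segment Bx By t01) Bx))//.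
  rewrite -mulrA ler_wpM2l ?(le_trans _ c0_ge1)// expr2.
  rewrite ler_wpM2r ?l2norm_ge0// addrC addKr l2normZ.
  by rewrite ler_piMl ?l2norm_ge0// ger0_norm// ltW.
rewrite -fE; have [->|e0] := eqVneq (l2norm e) 0.
  by rewrite mulr_ge0 ?sqr_ge0// (le_trans _ c0_ge1).
by rewrite expr2 ler_pM2l// lt_def e0 l2norm_ge0.
Qed.

(** At a boundary point the direction [w] may leave the ball. The chord therefore starts at the
    shrunken point [z = (1 - l) *: x] and has length [l]; Taylor's formula and the move of the
    Jacobian from [z] to [x] each cost at most [c0 * l ^+ 2], negligible after division by [l]. *)
Lemma jac_expansive x w : B x -> c0^-1 * l2norm w <= l2norm (jac F x *m w).
Proof.
move=> Bx; have [->|w0] := eqVneq w 0; first by rewrite mulmx0 !l2norm0 mulr0.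
have nw : 0 < l2norm w by rewrite lt_def l2norm_eq0 w0 l2norm_ge0.
have c0_gt0 : 0 < c0 by rewrite (lt_le_trans _ c0_ge1).
apply/ler_addgt0Pl => e e0.
(* Small enough for the total error [2 * c0 * l * l2norm w] to be at most [e]. *)
pose l := Num.min 1 (e / (2 * c0 * l2norm w)).
have Q0 : 0 < 2 * c0 * l2norm w by rewrite !mulr_gt0.
have l0 : 0 < l by rewrite lt_min ltr01 divr_gt0.
have l1 : l <= 1 by rewrite ge_min lexx.
have le : 2 * c0 * l2norm w * l <= e.
  by rewrite mulrC -ler_pdivlMr// ge_min lexx orbT.
clearbody l.
pose z := (1 - l) *: x; pose u := (l / l2norm w) *: w.
have nu : l2norm u = l.
  rewrite l2normZ ger0_norm ?divfK ?gt_eqF// divr_ge0 ?l2norm_ge0// ltW//.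
have Bz0 : l2norm z <= 1 - l.
  rewrite l2normZ ger0_norm ?subr_ge0// ler_piMr ?subr_ge0//.
have Bz : B z by rewrite /l2ball/= (le_trans Bz0)// gerBl ltW.
have By : B (z + u).
  by rewrite /l2ball/= (le_trans (ler_l2normD _ _))// nu -lerBrDr.
have zu : z + u - z = u by rewrite addrC addKr.
have h1 := taylor_l2ball Bz By; rewrite zu nu in h1.
have /andP[h2 _] := bilipF By Bz; rewrite zu nu in h2.
have h3 := jac_lipschitz u Bz Bx; rewrite nu in h3.
have zx : l2norm (z - x) <= l.
  have -> : z - x = - (l *: x) by apply/colP => i; rewrite !mxE; ring.
  by rewrite l2normN l2normZ gtr0_norm// ler_piMr// ltW.
have h4 : l2norm (F (z + u) - F z) <= l2norm (jac F x *m u) +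
    (c0 * l ^+ 2 + c0 * l * l).
  have -> : F (z + u) - F z = jac F x *m u +
      ((F (z + u) - F z - jac F z *m u) + (jac F z - jac F x) *m u).
    by rewrite mulmxBl subrKA [RHS]addrC subrK.
  rewrite (le_trans (ler_l2normD _ _))// lerD2l (le_trans (ler_l2normD _ _))//.
  apply: lerD => //; rewrite (le_trans h3)// (ler_wpM2r (ltW l0))//.
  by rewrite (ler_wpM2l (ltW c0_gt0)).
have h5 : l2norm (jac F x *m u) = l / l2norm w * l2norm (jac F x *m w).
  by rewrite -scalemxAr l2normZ ger0_norm// divr_ge0 ?l2norm_ge0// ltW.
have h6 := le_trans h2 h4; rewrite h5 in h6.
have h7 : l * (c0^-1 - 2 * c0 * l) <= l * (l2norm (jac F x *m w) / l2norm w).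
  by move: h6; rewrite expr2; lra.
rewrite ler_pM2l// ler_pdivlMr// in h7.
lra.
Qed.

Lemma dim_le : (d <= n)%N.
Proof.
have c0_gt0 : 0 < c0^-1 by rewrite invr_gt0 (lt_le_trans _ c0_ge1).
have B0 : B 0 by rewrite /l2ball/= l2norm0.
by have [] := expansive_left_inverse c0_gt0 (fun w => jac_expansive w B0).
Qed.

End Differential.

(** * Comparison of geodesic distances for a fixed matrix *)

Section Geodesics.
Context {R : realType}.
Notation I01 := (@unit_itv R).

Lemma measurable_speed n (g : R -> 'cV[R]_n) : C1_on I01 g ->
  measurable_fun I01 (fun t : R => l2norm (derive1 g t)).
Proof.
move=> [U [oU IU [dg cg]]].
apply: subspace_continuous_measurable_fun; first exact: measurable_itv.
apply: continuous_in_subspaceT => t /set_mem It.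
have h := (cv_continuous_nearP _ _).1 (cg 1 t (IU _ It)).
apply/cvgrPdist_le => e e0; apply: filterS (h e e0) => r.
rewrite -!derive1E; exact: ler_dist_l2norm.
Qed.

Lemma curve_length_le n m (g : R -> 'cV[R]_n) (h : R -> 'cV[R]_m) a :
  0 <= a -> C1_on I01 g -> C1_on I01 h ->
  (forall t, I01 t -> l2norm (derive1 h t) <= a * l2norm (derive1 g t)) ->
  (curve_length h <= a%:E * curve_length g)%E.
Proof.
move=> a0 Cg Ch hg; rewrite /curve_length.
have mI : measurable I01 by exact: measurable_itv.
have /measurable_EFinP mg := measurable_speed Cg.
have /measurable_EFinP mh := measurable_speed Ch.
rewrite -ge0_integralZl_EFin//; last by move=> t _; rewrite lee_fin l2norm_ge0.
apply: ge0_le_integral => //.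
- by move=> t _; rewrite lee_fin l2norm_ge0.
- by apply: measurable_funeM.
Qed.

Variables (d n m : nat) (F : 'cV[R]_d -> 'cV[R]_n) (c0 : R).
Notation B := (l2ball R d).
Hypothesis c0_ge1 : 1 <= c0.
Hypothesis smoothF : smooth_on B F.
Hypothesis bilipF : forall x y, B x -> B y ->
  c0^-1 * l2norm (x - y) <= l2norm (F x - F y) <= c0 * l2norm (x - y).
Hypothesis lipdF : forall x y, B x -> B y ->
  l2opnorm (fun v => 'd F x v - 'd F y v) <= c0 * l2norm (x - y).
Variables (eps : R) (Phi : 'M[R]_(m, n)).
Hypothesis eps01 : 0 < eps < 2^-1.
Hypothesis tangentPhi : forall v, unit_tangent F v ->
  1 - eps <= l2norm (Phi *m v) <= 1 + eps.

Let eps_gt0 : 0 < eps. Proof. by have /andP[] := eps01. Qed.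

Let eps_lt : eps < 1 / 2. Proof. by have /andP[] := eps01; rewrite div1r. Qed.

Let c0_gt0 : 0 < c0. Proof. exact: lt_le_trans c0_ge1. Qed.

Lemma tangent_sandwich x w : B x ->
  (1 - eps) * l2norm (jac F x *m w) <= l2norm (Phi *m (jac F x *m w)) <=
  (1 + eps) * l2norm (jac F x *m w).
Proof.
move=> Bx; have [->|v0] := eqVneq (jac F x *m w) 0.
  by rewrite mulmx0 !l2norm0 !mulr0 lexx.
have nv : 0 < l2norm (jac F x *m w) by rewrite lt_def l2norm_eq0 v0 l2norm_ge0.
set v := jac F x *m w in v0 nv *.
have := @tangentPhi ((l2norm v)^-1 *: v) _.
rewrite -scalemxAr l2normZ gtr0_norm ?invr_gt0// mulrC.
rewrite ler_pdivlMr// ler_pdivrMr//; apply; split.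
  by rewrite l2normZ gtr0_norm ?invr_gt0// mulVf// gt_eqF.
exists x => //; exists ((l2norm v)^-1 *: w) => //.
by rewrite diff_jac -scalemxAr.
Qed.

(** With [r] the length of [x - y], the linear part contributes at least
    [(1 - eps) / c0 * r >= r / (2 * c0)]. The Taylor remainder, multiplied by at most [n], is at
    most [n * c0 * r ^+ 2 <= r / (4 * c0)]. *)
Lemma near_pairs_expansive x y : (0 < n)%N -> frob Phi <= n%:R ->
  B x -> B y -> l2norm (x - y) <= (4 * c0 ^+ 2 * n%:R)^-1 ->
  (4 * c0)^-1 * l2norm (x - y) <= l2norm (Phi *m F x - Phi *m F y).
Proof.
move=> n0 fn Bx By xy.
have n0' : 0 < n%:R :> R by rewrite ltr0n.
set r := l2norm (x - y) in xy *; have r0 : 0 <= r by exact: l2norm_ge0.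
have h1 := taylor_l2ball c0_ge1 smoothF lipdF By Bx; rewrite -/r in h1.
have /andP[h2 _] := tangent_sandwich (x - y) By.
have h3 := jac_expansive c0_ge1 smoothF bilipF lipdF (x - y) By; rewrite -/r in h3.
have h4 := lerB_l2dist (Phi *m (jac F y *m (x - y)))
  (Phi *m (jac F y *m (x - y)) - (Phi *m F x - Phi *m F y)).
rewrite subKr in h4.
have h5 : l2norm (Phi *m (jac F y *m (x - y)) - (Phi *m F x - Phi *m F y)) <=
    n%:R * (c0 * r ^+ 2).
  rewrite -!mulmxBr -l2normN -mulmxN opprB.
  rewrite (le_trans (l2norm_mulmx _ _))//.
  by apply: ler_pM => //; rewrite ?frob_ge0 ?l2norm_ge0.
have h6 : n%:R * (c0 * r ^+ 2) <= (4 * c0)^-1 * r.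
  have -> : n%:R * (c0 * r ^+ 2) = n%:R * c0 * r * r by ring.
  rewrite ler_wpM2r// (le_trans (ler_wpM2l _ xy))//.
    by rewrite mulr_ge0// ltW.
  rewrite le_eqVlt; apply/orP; left; apply/eqP; field.
  by rewrite ?gt_eqF.
have h7 : (1 - eps) * (c0^-1 * r) <= (1 - eps) * l2norm (jac F y *m (x - y)).
  by apply: ler_wpM2l => //; move: eps_lt; lra.
have h8 : 2^-1 * (c0^-1 * r) <= (1 - eps) * (c0^-1 * r).
  by apply: ler_wpM2r; [rewrite mulr_ge0// invr_ge0 ltW|move: eps_lt; lra].
have h9 : (4 * c0)^-1 * r = 2^-1 * (2^-1 * (c0^-1 * r)).
  by field; rewrite gt_eqF.
lra.
Qed.

Hypothesis injPhi : exists2 c, 0 < c & forall x y, B x -> B y ->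
  c * l2norm (x - y) <= l2norm (Phi *m F x - Phi *m F y).

(** The competitor is the image under [Phi] of a curve in the manifold; lifting that curve to the
    ball shows that its velocities are tangent vectors. *)
Lemma geodesic_le x y : (F @` B) x -> (F @` B) y ->
  (geodesic_dist (mulmx Phi @` (F @` B)) (Phi *m x) (Phi *m y)
    <= (1 + eps)%:E * geodesic_dist (F @` B) x y)%E.
Proof.
move=> Mx My.
have e1 : 0 < 1 + eps by move: eps_gt0; lra.
rewrite -lee_pdivrMl//; apply: le_ereal_inf_tmp => _ [g [Cg gM g0 g1] <-].
rewrite lee_pdivrMl//.
have gg' := C1_on_pair Cg.
have c0i : 0 < c0^-1 by rewrite invr_gt0.
have [|u [w [uw uP]]] := @C1_pair_lift R d n F (jac F) B c0 (ltW c0_gt0)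
  (taylor_l2ball c0_ge1 smoothF lipdF)
  (fun x y Bx By v => jac_lipschitz lipdF v Bx By) _ c0i
  (fun x y Bx By => (andP (bilipF Bx By)).1)
  (fun x Bx w => jac_expansive c0_ge1 smoothF bilipF lipdF w Bx) _ _ gg'.
  by move=> t It; apply: gM; exists t.
have Pgg' : C1_pair (fun t => Phi *m g t) (fun t => Phi *m derive1 g t).
  apply: C1_pairI => t It; exists (frob Phi) => e e0.
  apply: filterS (gg' t It e e0) => r [h1 h2].
  split.
    have -> : Phi *m g r - Phi *m g t - (r - t) *: (Phi *m derive1 g t) =
      Phi *m (g r - g t - (r - t) *: derive1 g t).
      by rewrite !mulmxBr -scalemxAr.
    by rewrite (le_trans (l2norm_mulmx _ _))// -mulrA ler_wpM2l ?frob_ge0.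
  by rewrite -mulmxBr (le_trans (l2norm_mulmx _ _))// ler_wpM2l ?frob_ge0.
have [h [Ch hP]] := C1_pair_extend Pgg'.
have I0 : I01 0 by apply/unit_itvP; rewrite lexx ler01.
have I1 : I01 1 by apply/unit_itvP; rewrite lexx ler01.
apply: (@le_trans _ _ (curve_length h)).
  apply: ereal_inf_lbound; exists h => //; split => //.
  - move=> _ [t It <-]; rewrite (hP t It).1; exists (g t) => //.
    by apply: gM; exists t.
  - by rewrite (hP 0 I0).1 g0.
  - by rewrite (hP 1 I1).1 g1.
apply: curve_length_le => //; first exact: ltW.
move=> t It; rewrite (hP t It).2; have [But _ <-] := uP t It.
by have /andP[] := tangent_sandwich (w t) But.
Qed.

(** A curve in the image is lifted to the ball through [Phi *m F] and pushed back by [F]. The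
    constant of [injPhi] only makes the lift possible; the lengths are compared by the tangent
    hypothesis alone, so this constant does not enter the distortion. *)
Lemma geodesic_ge x y : (F @` B) x -> (F @` B) y ->
  ((1 - eps)%:E * geodesic_dist (F @` B) x y <=
   geodesic_dist (mulmx Phi @` (F @` B)) (Phi *m x) (Phi *m y))%E.
Proof.
move=> [x0 Bx0 <-] [y0 By0 <-] {x y}.
have e1 : 0 < 1 - eps by move: eps_lt; lra.
apply: le_ereal_inf_tmp => _ [h [Ch hM h0 h1] <-].
have hh' := C1_on_pair Ch.
have [c c_gt0 cP] := injPhi.
(* One constant for the chords, through [c], and for the Jacobian, through [(1 - eps) * c0^-1], as
   [eps < 1 / 2]. *)
pose c1 := Num.min c (2^-1 * c0^-1).
have c1_gt0 : 0 < c1 by rewrite lt_min c_gt0 mulr_gt0 ?invr_gt0.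
have c1c : c1 <= c by rewrite ge_min lexx.
have c1e : c1 <= (1 - eps) * c0^-1.
  rewrite ge_min; apply/orP; right; rewrite ler_wpM2r ?invr_ge0 ?ltW//; move: eps_lt; lra.
pose G x := Phi *m F x; pose A x := Phi *m jac F x.
pose K := frob Phi * c0 + c0.
have K0 : 0 <= K by rewrite addr_ge0 ?mulr_ge0 ?frob_ge0// ltW.
have fK : frob Phi * c0 <= K by rewrite lerDl ltW.
have taylorG x y : B x -> B y ->
    l2norm (G y - G x - A x *m (y - x)) <= K * l2norm (y - x) ^+ 2.
  move=> Bx By; rewrite /G /A -mulmxA -!mulmxBr (le_trans (l2norm_mulmx _ _))//.
  apply: (@le_trans _ _ (frob Phi * c0 * l2norm (y - x) ^+ 2)); last first.
    by rewrite ler_wpM2r ?sqr_ge0.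
  rewrite -mulrA ler_wpM2l ?frob_ge0//; exact: (taylor_l2ball c0_ge1).
have lipA x y : B x -> B y -> forall v,
    l2norm ((A x - A y) *m v) <= K * l2norm (x - y) * l2norm v.
  move=> Bx By v; rewrite /A -mulmxBr -mulmxA (le_trans (l2norm_mulmx _ _))//.
  apply: (@le_trans _ _ (frob Phi * c0 * l2norm (x - y) * l2norm v)); last first.
    by rewrite ler_wpM2r ?l2norm_ge0// ler_wpM2r ?l2norm_ge0.
  by rewrite -!mulrA ler_wpM2l ?frob_ge0// mulrA; exact: jac_lipschitz.
have expG x y : B x -> B y -> c1 * l2norm (x - y) <= l2norm (G x - G y).
  by move=> Bx By; rewrite (le_trans _ (cP _ _ Bx By))// ler_wpM2r ?l2norm_ge0.
have expA x : B x -> forall w, c1 * l2norm w <= l2norm (A x *m w).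
  move=> Bx w; rewrite /A -mulmxA.
  have /andP[hl _] := tangent_sandwich w Bx; apply: le_trans hl.
  apply: (@le_trans _ _ ((1 - eps) * c0^-1 * l2norm w)).
    by rewrite ler_wpM2r ?l2norm_ge0.
  rewrite -mulrA ler_wpM2l ?(ltW e1)//; exact: (jac_expansive c0_ge1).
have [|u [w [uw uP]]] := C1_pair_lift K0 taylorG lipA c1_gt0 expG expA hh'.
  move=> t It; have [|z [z' Bz' <-] hz] := hM (h t); first by exists t.
  by exists z'.
have [g [Cg gP]] := C1_pair_extend (@C1_pair_push R d n F (jac F) B c0 (ltW c0_gt0)
  (taylor_l2ball c0_ge1 smoothF lipdF)
  (fun x y Bx By v => jac_lipschitz lipdF v Bx By) _ _ uw
  (fun t It => let: And3 a _ _ := uP t It in a)).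
have I0 : I01 0 by apply/unit_itvP; rewrite lexx ler01.
have I1 : I01 1 by apply/unit_itvP; rewrite lexx ler01.
have lift_end t z : I01 t -> B z -> h t = Phi *m F z -> g t = F z.
  move=> It Bz hz; rewrite (gP t It).1/=; congr F; have [But Gu _] := uP t It.
  apply/eqP; rewrite -subr_eq0 -l2norm_eq0 eq_le l2norm_ge0 andbT.
  rewrite -(pmulr_rle0 _ c1_gt0) (le_trans (expG _ _ But Bz))//.
  by rewrite Gu hz subrr l2norm0.
rewrite muleC -lee_pdivlMr//; apply: (@le_trans _ _ (curve_length g)).
  apply: ereal_inf_lbound; exists g => //; split => //.
  - move=> _ [t It <-]; rewrite (gP t It).1 /=; exists (u t) => //.
    by have [] := uP t It.
  - exact: lift_end.
  - exact: lift_end.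
rewrite lee_pdivlMr// muleC -lee_pdivlMl//.
apply: curve_length_le => //; first by rewrite invr_ge0 ltW.
move=> t It; rewrite (gP t It).2; have [But _ <-] := uP t It.
rewrite ler_pdivlMl// /A -mulmxA.
by have /andP[] := tangent_sandwich (w t) But.
Qed.

End Geodesics.

(** * Probability that a vector with many large coordinates is small on all rows *)

Section SmallBall.
Context {R : realType}.
Variables m n : nat.
Notation mask := {ffun 'I_m * 'I_n -> bool}.
Implicit Types (a b : mask) (v : 'I_n -> R) (K : {set 'I_n}).

(** A coordinate of the sparse matrix times [v] without the factor [s^(-1/2)]: [a] holds the signs,
    with true for [-1], and [b] the positions of the nonzero entries. *)
Definition rowsum a b v (i : 'I_m) : R :=
  \sum_j (-1) ^+ a (i, j) * (b (i, j))%:R * v j.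

Definition small_rows v (tau : R) (x : mask * mask) : bool :=
  [forall i, `|rowsum x.1 x.2 v i| <= tau].

Definition touched b K : {set 'I_m} := [set i | [exists j in K, b (i, j)]]%SET.

(* Flipping one sign in K of each row of a set of touched rows moves a small
   configuration out of the small ones, and these moves are injective. *)
Lemma card_small_signs b v K tau : (forall j, j \in K -> tau < `|v j|) ->
  (#|[set a : mask | small_rows v tau (a, b)]%SET| * 2 ^ #|touched b K|
    <= 2 ^ (m * n))%N.
Proof.
move=> Kv; set Q := finset _.
(* One column of [K] meeting row [i]; the move associated with a set of rows flips the sign at these
   positions. *)
pose pk i := [pick j in K | b (i, j)].
pose flip (x : mask * {set 'I_m}) : mask :=
  [ffun p : 'I_m * 'I_n => x.1 p (+) ((p.1 \in x.2) && (Some p.2 == pk p.1))].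
rewrite -card_powerset -cardsX.
have -> : (2 ^ (m * n) = #|[set: mask]%SET|)%N.
  by rewrite cardsT card_ffun card_bool card_prod !card_ord.
rewrite -(@card_in_imset _ _ flip); first exact/subset_leq_card/finset.subsetT.
move=> [a A] [a' A']; rewrite !inE/= => /andP[Qa sA] /andP[Qa' sA'] eqf.
have eqp i j : a (i, j) (+) ((i \in A) && (Some j == pk i)) =
    a' (i, j) (+) ((i \in A') && (Some j == pk i)).
  by have := congr1 (fun f : mask => f (i, j)) eqf; rewrite !ffunE.
have AA' : A = A'.
  apply/setP => i; apply/eqP/negPn/negP => neA.
  have ti : i \in touched b K.
    move: neA; case: (boolP (i \in A)) => [iA _|_]; first exact: (fintype.subsetP sA).
    by case: (boolP (i \in A')) => [iA' _|//]; exact: (fintype.subsetP sA').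
  move: ti; rewrite inE => /existsP[j0 j0K].
  case E : (pk i) => [j|]; last first.
    by move: E; rewrite /pk; case: pickP => // /(_ j0) /=; rewrite j0K.
  have [jK bij] : j \in K /\ b (i, j).
    by move: E; rewrite /pk; case: pickP => // x /andP[? ?] [<-].
  (* If [i] lies in only one of [A] and [A'], the signs of [a] and [a'] are opposite at [(i, j)] and
     equal elsewhere in row [i]. The two row sums then differ by [2 |v j| > 2 tau] and cannot both
     be at most [tau]. *)
  have eqo j' : j' != j -> a (i, j') = a' (i, j').
    move=> nj; have := eqp i j'; rewrite E.
    have -> : (Some j' == Some j) = false by apply/negbTE.
    by rewrite !andbF !addbF.
  have neqj : a (i, j) = ~~ a' (i, j).
    have := eqp i j; rewrite E eqxx !andbT.
    by move: neA; case: (i \in A); case: (i \in A'); case: (a (i, j));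
      case: (a' (i, j)).
  have dif : rowsum a b v i - rowsum a' b v i = 2 * ((-1) ^+ a (i, j) * v j).
    rewrite /rowsum -sumrB (bigD1 j)//= big1 ?addr0 => [|j' nj]; last first.
      by rewrite eqo// subrr.
    by rewrite neqj bij; case: (a' (i, j)); rewrite /= ?expr0 ?expr1; ring.
  move/forallP : Qa => /(_ i) /= h1; move/forallP : Qa' => /(_ i) /= h2.
  have := ler_normB (rowsum a b v i) (rowsum a' b v i).
  rewrite dif normrM (@ger0_norm _ 2)// normrM normrX normrN1 expr1n mul1r.
  by have := Kv j jK; lra.
subst A'; congr pair; apply/ffunP => -[i j].
by have := eqp i j; move/addIb.
Qed.

Variables (s : nat) (q : mask -> R).
Hypothesis s_gt0 : (0 < s)%N.
Hypothesis q_ge0 : forall b, 0 <= q b.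
Hypothesis q_sum1 : \sum_b q b = 1.
(** A column supported in [R0] has one of the [s]-subsets of [R0] as its support, each with
    probability at most [(s / m) ^ s]; independence of the columns gives the power. *)
Hypothesis q_columns : forall K (R0 : {set 'I_m}),
  \sum_(b : mask | [forall j in K, forall i, b (i, j) ==> (i \in R0)]) q b
    <= ('C(#|R0|, s)%:R * (s%:R / m%:R) ^+ s) ^+ #|K|.

(* The law of independent uniform signs and of a mask distributed as [q]. *)
Definition prb (Q : pred (mask * mask)) : R :=
  \sum_b q b * (#|[set a | Q (a, b)]%SET|%:R / 2 ^+ (m * n)).

Lemma prb_union (I : finType) (D : pred I) (Q : I -> pred (mask * mask)) :
  prb (fun x => [exists i, D i && Q i x]) <= \sum_(i | D i) prb (Q i).
Proof.
rewrite /prb exchange_big/=; apply: ler_sum => b _.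
rewrite -mulr_sumr ler_wpM2l// -mulr_suml ler_wpM2r ?invr_ge0 ?exprn_ge0//.
rewrite -natr_sum ler_nat.
have -> : (\sum_(i | D i) #|[set a | Q i (a, b)]%SET| =
    \sum_a \sum_(i | D i) Q i (a, b))%N.
  rewrite exchange_big/=; apply: eq_bigr => i _.
  rewrite -sum1_card big_mkcond/=; apply: eq_bigr => a _.
  by rewrite inE; case: (Q i _).
rewrite -sum1_card big_mkcond/=; apply: leq_sum => a _; rewrite inE.
by case: existsP => // -[i /andP[Di Qi]]; rewrite (bigD1 i)//= Qi.
Qed.

(** With [x = k / N], the term of index [k] in the expansion of [(1 + x) ^ N] is at most
    [expR (x N) = expR k], and [expR 1 <= 4]. *)
Lemma bin_le_pow (N k : nat) : (0 < k)%N -> (0 < N)%N ->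
  'C(N, k)%:R <= (4 * N%:R / k%:R) ^+ k :> R.
Proof.
move=> k0 N0; pose x : R := k%:R / N%:R.
have k0' : 0 < k%:R :> R by rewrite ltr0n.
have N0' : 0 < N%:R :> R by rewrite ltr0n.
have x0 : 0 < x by rewrite divr_gt0.
have e4 : expR 1 <= 4 :> R.
  have := expR_ge1Dx (- 2^-1 : R).
  rewrite expRN => h.
  have h2 : expR (2^-1) <= 2 :> R.
    rewrite -(invrK (expR _)) -[leRHS]invrK lef_pV2 ?posrE ?invr_gt0 ?expR_gt0//.
    by lra.
  have -> : (1 : R) = 2^-1 + 2^-1 by lra.
  rewrite expRD; have := expR_gt0 (2^-1 : R); nra.
have h1 : 'C(N, k)%:R * x ^+ k <= (1 + x) ^+ N.
  rewrite exprDn; have [kN|kN] := leqP k N; last first.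
    rewrite bin_small// mul0r sumr_ge0// => i _.
    by rewrite mulrn_wge0// mulr_ge0 ?exprn_ge0// ltW.
  pose k' := Ordinal (kN : (k < N.+1)%N).
  rewrite (bigD1 k')//= expr1n mul1r mulr_natl lerDl sumr_ge0// => i _.
  by rewrite mulrn_wge0// mulr_ge0 ?exprn_ge0// ltW.
have h2 : (1 + x) ^+ N <= 4 ^+ k.
  rewrite (le_trans (y := expR x ^+ N))//.
    by rewrite ler_pXn2r ?nnegrE ?expR_ge0 ?expR_ge1Dx// addr_ge0// ltW.
  rewrite -expRM_natl /x mulrCA mulfV ?gt_eqF// expRM_natl.
  by rewrite ler_pXn2r ?nnegrE ?expR_ge0.
have := le_trans h1 h2; rewrite -ler_pdivlMr ?exprn_gt0// -expr_div_n => h.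
by rewrite (le_trans h)// /x invf_div mulrA.
Qed.

(** Union bound over the sets of [l] rows that may contain all touched rows. With
    [y = 4 l / m <= 1/16], one column fits in such a set with probability at most [y ^ s], all
    columns of [K] with at most [y ^ (64 l)], and there are at most [(16 / y) ^ l] sets; the product
    is [(16 y^63) ^ l]. *)
Lemma prb_touched K l : (64 * l <= s * #|K|)%N -> (s * #|K| <= m)%N ->
  (0 < l)%N -> \sum_(b : mask | (#|touched b K| <= l)%N) q b <= 2 ^- l.
Proof.
move=> lK Km l0.
have K0 : (0 < #|K|)%N by move: lK; case: #|K| => //; lia.
have m0 : (0 < m)%N by nia.
have lm : (l <= m)%N by lia.
pose p : R := 'C(l, s)%:R * (s%:R / m%:R) ^+ s.
have h1 : \sum_(b : mask | (#|touched b K| <= l)%N) q b <= 'C(m, l)%:R * p ^+ #|K|.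
  apply: (@le_trans _ _ (\sum_(R0 : {set 'I_m} | #|R0| == l)
      \sum_(b : mask | [forall j in K, forall i, b (i, j) ==> (i \in R0)]) q b)).
    rewrite (exchange_big_dep xpredT)//= [leRHS]big_mkcond/= big_mkcond/=.
    apply: ler_sum => b _; case: ifPn => [tl|_]; last first.
      by apply: sumr_ge0 => R0 _.
    (* The touched rows are padded to exactly [l] rows. *)
    have [R0 R0l tR0] : exists2 R0 : {set 'I_m}, #|R0| = l & touched b K \subset R0.
      have h : (#|touched b K| + (l - #|touched b K|) <= #|[set: 'I_m]%SET|)%N.
        by rewrite cardsT card_ord subnKC.
      have : (l - #|touched b K| <= #|(~: touched b K)%SET|)%N.
        by rewrite -(leq_add2l #|touched b K|) cardsC card_ord subnKC.
      move=> /card_geqP[sq [usq szq ssq]].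
      exists (touched b K :|: [set x in sq])%SET; last exact: finset.subsetUl.
      rewrite cardsU disjoint_setI0; last first.
        rewrite -setI_eq0; apply/eqP/setP => z; rewrite !inE.
        apply/negbTE/negP => /andP[h1 /ssq]; rewrite !inE => /negP; apply.
        exact: h1.
      have -> : #|[set x in sq]%SET| = size sq by rewrite cardsE; apply/card_uniqP.
      by rewrite cards0 subn0 szq subnKC.
    rewrite (bigD1 R0)/=; last first.
      rewrite R0l eqxx/=; apply/forallP => j; apply/implyP => jK.
      apply/forallP => i; apply/implyP => bij; apply: (fintype.subsetP tR0).
      by rewrite inE; apply/existsP; exists j; rewrite jK.
    by rewrite lerDl sumr_ge0.
  apply: (@le_trans _ _ (\sum_(R0 : {set 'I_m} | #|R0| == l) p ^+ #|K|)).
    by apply: ler_sum => R0 /eqP R0l; rewrite (le_trans (q_columns _ _))// R0l.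
  rewrite sumr_const -[leLHS]mulr_natl ler_wpM2r//.
    by rewrite exprn_ge0// mulr_ge0// exprn_ge0// divr_ge0.
  by rewrite ler_nat -[X in 'C(X, _)](card_ord m) -card_draws cardsE.
apply: (le_trans h1).
(* A column has [s] nonzero entries and cannot fit in fewer rows: the binomial vanishes. *)
have [ls|sl] := ltnP l s.
  by rewrite /p (bin_small ls) mul0r expr0n gtn_eqF// mulr0 invr_ge0 exprn_ge0.
pose y : R := 4 * l%:R / m%:R.
have m0' : 0 < m%:R :> R by rewrite ltr0n.
have l0' : 0 < l%:R :> R by rewrite ltr0n.
have s0' : 0 < s%:R :> R by rewrite ltr0n.
have y0 : 0 < y by rewrite divr_gt0// mulr_gt0.
have y1 : y <= 16^-1.
  rewrite /y ler_pdivrMr// ler_pdivlMl//.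
  by rewrite -natrM -natrM ler_nat; lia.
have py : p <= y ^+ s.
  rewrite /p (le_trans (ler_wpM2r _ (bin_le_pow s_gt0 l0)))//.
  rewrite -exprMn ler_pXn2r ?nnegrE ?(ltW y0)//.
  rewrite le_eqVlt; apply/orP; left; apply/eqP; rewrite /y; field.
  by rewrite ?gt_eqF.
have p0 : 0 <= p by rewrite mulr_ge0// exprn_ge0// divr_ge0.
have pK : p ^+ #|K| <= y ^+ (64 * l).
  rewrite (le_trans (y := (y ^+ s) ^+ #|K|))//.
    by rewrite ler_pXn2r ?nnegrE ?exprn_ge0 ?(ltW y0).
  by rewrite -exprM ler_wiXn2l ?(ltW y0)//; lra.
have Cm : 'C(m, l)%:R <= (16 / y) ^+ l :> R.
  rewrite (le_trans (bin_le_pow l0 m0))// ler_pXn2r ?nnegrE ?divr_ge0 ?(ltW y0)//.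
  rewrite le_eqVlt; apply/orP; left; apply/eqP; rewrite /y; field.
  by rewrite ?gt_eqF.
apply: (@le_trans _ _ ((16 / y) ^+ l * y ^+ (64 * l))).
  by apply: ler_pM => //; exact: exprn_ge0.
rewrite exprM -exprMn -exprVn ler_pXn2r ?nnegrE ?mulr_ge0 ?exprn_ge0 ?divr_ge0
  ?invr_ge0 ?(ltW y0)//.
rewrite (exprSr _ 63) [_ * y]mulrC mulrA divfK ?gt_eqF//.
have : y ^+ 63 <= y ^+ 2 by rewrite ler_wiXn2l ?(ltW y0)//; lra.
rewrite expr2; nra.
Qed.

(** Either at most [l] rows are touched, which is rare by [prb_touched], or the random signs alone
    make all rows small with probability at most [2 ^- l]. For [l = 0] the bound exceeds 1. *)
Lemma prb_small v K tau l : (forall j, j \in K -> tau < `|v j|) ->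
  (64 * l <= s * #|K|)%N -> (s * #|K| <= m)%N ->
  prb (small_rows v tau) <= 2 * 2 ^- l.
Proof.
move=> Kv lK Km.
have cle b : #|[set a | small_rows v tau (a, b)]%SET|%:R / 2 ^+ (m * n) <=
    2 ^- #|touched b K| :> R.
  rewrite ler_pdivrMr ?exprn_gt0// mulrC ler_pdivlMr ?exprn_gt0//.
  by rewrite -!natrX -natrM ler_nat card_small_signs.
have i2 t : 2 ^- t <= 1 :> R by rewrite invf_le1 ?exprn_gt0// exprn_ege1// ler1n.
case: l lK => [_|l lK].
  rewrite expr0 invr1 mulr1 (le_trans (y := 1))// ?ler1n// -q_sum1.
  by apply: ler_sum => b _; rewrite ler_piMr// (le_trans (cle _)).
rewrite /prb (bigID (fun b => #|touched b K| <= l.+1)%N)/= mulr2n mulrDl mul1r.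
apply: lerD.
  rewrite (le_trans _ (prb_touched lK Km _))//.
  by apply: ler_sum => b _; rewrite ler_piMr// (le_trans (cle _)).
apply: (@le_trans _ _ (\sum_(b | ~~ (#|touched b K| <= l.+1)%N) q b * 2 ^- l.+1)).
  apply: ler_sum => b; rewrite -ltnNge => lb; rewrite ler_wpM2l// (le_trans (cle _))//.
  by rewrite lef_pV2 ?posrE ?exprn_gt0// ler_weXn2l ?ler1n// ltnW.
rewrite -mulr_suml ler_piMl ?invr_ge0 ?exprn_ge0// -q_sum1.
by rewrite [leRHS](bigID (fun b => #|touched b K| <= l.+1)%N)/= lerDr sumr_ge0.
Qed.

(** [K] is cut down to [minn k (m %/ s)] columns, so that they have at most [m] nonzero entries in
    total. *)
Lemma prb_small_rows v K tau k : (forall j, j \in K -> tau < `|v j|) ->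
  (k <= #|K|)%N ->
  prb (small_rows v tau) <= 2 * 2 ^- ((s * minn k (m %/ s)) %/ 64).
Proof.
move=> Kv kK.
have : (minn k (m %/ s) <= #|K|)%N by rewrite geq_min kK.
move=> /card_geqP[sq [usq szq ssq]].
have szK : #|[set x in sq]%SET| = minn k (m %/ s).
  by rewrite cardsE -szq; apply/card_uniqP.
apply: (@prb_small v [set x in sq]%SET).
- by move=> j; rewrite inE => /ssq/Kv.
- by rewrite szK mulnC leq_trunc_div.
- rewrite szK (@leq_trans (s * (m %/ s)))//; last by rewrite mulnC leq_trunc_div.
  by rewrite leq_mul2l geq_minr orbT.
Qed.

End SmallBall.

(** * Laws of random variables with finitely many values *)

Section FiniteLaw.
Context {R : realType} {disp : measure_display} {T : measurableType disp}.
Variable P : probability T R.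

Lemma fineK_prob (A : set T) : measurable A -> (fine (P A))%:E = P A.
Proof. by move=> mA; rewrite fineK// fin_num_measure. Qed.

Lemma prob_finite_law (I : finType) (X : T -> I) (Q : pred I) :
  (forall x, measurable [set w | X w = x]) ->
  measurable [set w | Q (X w)] /\
  P [set w | Q (X w)] = (\sum_(x | Q x) fine (P [set w | X w = x]))%:E.
Proof.
move=> mX.
have H (r : seq I) : uniq r -> measurable [set w | X w \in r] /\
    P [set w | X w \in r] = (\sum_(x <- r) fine (P [set w | X w = x]))%:E.
  elim: r => [_|x r IH /= /andP[xr /IH[mr Pr]]].
    rewrite big_nil (_ : [set w | _] = set0) ?measure0//.
    by apply/seteqP; split => w.
  have -> : [set w | X w \in x :: r] = [set w | X w = x] `|` [set w | X w \in r].
    apply/seteqP; split=> w /=; rewrite inE.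
      by case/orP => [/eqP|] ?; [left|right].
    by case=> [->|->]; rewrite ?eqxx ?orbT.
  split; first exact: measurableU.
  rewrite measureU//; last first.
    by apply/seteqP; split => // w [/= ->]; rewrite (negbTE xr).
  by rewrite big_cons EFinD -Pr fineK_prob.
have [m1 P1] := H (enum Q) (enum_uniq Q).
have QE : [set w | Q (X w)] = [set w | X w \in enum Q].
  by apply/seteqP; split => w /=; rewrite mem_enum.
by rewrite QE; split => //; rewrite P1 big_enum.
Qed.

Lemma prod_EFin (I : Type) (r : seq I) (D : pred I) (f : I -> R) :
  (\prod_(i <- r | D i) (f i)%:E)%E = (\prod_(i <- r | D i) f i)%:E.
Proof. by rewrite (big_morph EFin EFinM erefl). Qed.

End FiniteLaw.

(** * The joint law of the signs and of the positions in the SJLT *)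

Section SjltLaw.
Context {R : realType} {disp : measure_display} {T : measurableType disp}.
Variables (P : probability T R) (m n s : nat).
Variables sigma delta : 'I_m -> 'I_n -> {RV P >-> R}.
Hypothesis sd : sjlt_factors s sigma delta.
Notation mask := {ffun 'I_m * 'I_n -> bool}.

(** True encodes [-1], so the sign is recovered as a power of [-1]. *)
Definition sign_mask (w : T) : mask := [ffun p => sigma p.1 p.2 w == -1].
Definition delta_mask (w : T) : mask := [ffun p => delta p.1 p.2 w == 1].
Definition mask_law (b : mask) : R := fine (P [set w | delta_mask w = b]).

Let in_sigma_algebra_of (J : Type) (X : J -> {RV P >-> R}) j (B : set R) :
  measurable B -> sigma_algebra_of X (X j @^-1` B).
Proof.
move=> mB; apply: sub_sigma_algebra; exists j => //.
by exists B => //; rewrite setTI.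
Qed.

Let sigma_algebra_ofI (J : finType) (X : J -> {RV P >-> R}) (K : finType)
    (A : K -> set T) :
  (forall k, sigma_algebra_of X (A k)) ->
  sigma_algebra_of X [set w | forall k, A k w].
Proof.
move=> hA; pose G := \bigcup_i preimage_set_system [set: T] (X i) measurable.
have -> : [set w | forall k, A k w] = \bigcap_(k in [set: K]) A k.
  by apply/seteqP; split => [w h k _|w h k]; exact: h.
have : measurable (\bigcap_(k in [set: K]) A k : set (g_sigma_algebraType G)).
  apply: fin_bigcap_measurable; first exact: finite_finset.
  by move=> k _; exact: hA.
by [].
Qed.

Let sigma_algebra_ofT (J : finType) (X : J -> {RV P >-> R}) :
  sigma_algebra_of X setT.
Proof.
(* The whole space is the intersection indexed by the empty type. *)
have -> : [set: T] = [set w | forall k : void, (fun _ : void => set0) k w].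
  by apply/seteqP; split => // w _ [].
exact: sigma_algebra_ofI.
Qed.

Let sigma_algebra_of_measurable (J : Type) (X : J -> {RV P >-> R}) A :
  sigma_algebra_of X A -> measurable A.
Proof.
apply: smallest_sub; first exact: sigma_algebra_measurable.
move=> _ [j _ [B mB <-]]; rewrite setTI -[_ @^-1` _]setTI.
exact: (measurable_funP (X j)).
Qed.

Let sgn (t : bool) : R := if t then -1 else 1.

Let sign_maskE a : [set w | sign_mask w = a] =
  [set w | forall p, (sigma p.1 p.2 @^-1` [set sgn (a p)]) w].
Proof.
apply/seteqP; split=> w /=.
  move=> <- p; rewrite ffunE /sgn.
  have [h _ _] := sigma_rademacher sd p.1 p.2.
  by case: eqP => // ne; have [] := h w.
move=> h; apply/ffunP => p; rewrite ffunE; have /= -> := h p.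
by rewrite /sgn; case: (a p); rewrite ?eqxx// gt_eqF//; lra.
Qed.

Let delta_maskE b : [set w | delta_mask w = b] =
  [set w | forall p, (delta p.1 p.2 @^-1` [set (b p)%:R]) w].
Proof.
apply/seteqP; split=> w /=.
  move=> <- p; rewrite ffunE.
  case: eqP => [->//|ne]; by have [-> //|] := (delta_01 sd) p.1 p.2 w.
move=> h; apply/ffunP => p; rewrite ffunE; have /= -> := h p.
by case: (b p); rewrite ?eqxx//= lt_eqF// ltr01.
Qed.

Let sign_in a : sigma_algebra_of (fun ij : 'I_m * 'I_n => sigma ij.1 ij.2)
  [set w | sign_mask w = a].
Proof.
rewrite sign_maskE; apply: sigma_algebra_ofI => p.
exact: (@in_sigma_algebra_of _ (fun ij : 'I_m * 'I_n => sigma ij.1 ij.2)).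
Qed.

Let delta_in b : sigma_algebra_of (fun ij : 'I_m * 'I_n => delta ij.1 ij.2)
  [set w | delta_mask w = b].
Proof.
rewrite delta_maskE; apply: sigma_algebra_ofI => p.
exact: (@in_sigma_algebra_of _ (fun ij : 'I_m * 'I_n => delta ij.1 ij.2)).
Qed.

Let sign_law a : P [set w | sign_mask w = a] = (2 ^- (m * n))%:E.
Proof.
have := @sigma_indep _ _ _ _ _ _ _ _ _ sd [set: 'I_m * 'I_n]%SET
  (fun p => sigma p.1 p.2 @^-1` [set sgn (a p)]).
have -> : \bigcap_(i in [set` [set: 'I_m * 'I_n]%SET])
    (sigma i.1 i.2 @^-1` [set sgn (a i)]) = [set w | sign_mask w = a].
  rewrite sign_maskE; apply/seteqP; split => [w h p|w h p _]; last exact: h.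
  by apply: h; rewrite /= inE.
move=> ->; last first.
  move=> p _; exact: (@in_sigma_algebra_of _ (fun _ : unit => sigma p.1 p.2) tt).
rewrite (eq_bigr (fun=> (2^-1)%:E)) => [|p _]; last first.
  have [_ h1 h2] := sigma_rademacher sd p.1 p.2.
  by rewrite /sgn; case: (a p).
rewrite prod_EFin prodr_const cardsT card_prod !card_ord exprVn//.
Qed.

Lemma mask_law_ge0 b : 0 <= mask_law b.
Proof. by rewrite fine_ge0. Qed.

Let mD b : measurable [set w | delta_mask w = b].
Proof. exact: sigma_algebra_of_measurable (delta_in b). Qed.

Lemma mask_law_sum1 : \sum_b mask_law b = 1.
Proof.
have [_] := prob_finite_law P xpredT mD.
rewrite (_ : [set w | _] = setT) ?probability_setT; first by case.
by apply/seteqP; split.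
Qed.

Lemma joint_law (a b : mask) :
  P [set w | (sign_mask w, delta_mask w) = (a, b)] =
  (2 ^- (m * n) * mask_law b)%:E.
Proof.
have -> : [set w | (sign_mask w, delta_mask w) = (a, b)] =
    [set w | sign_mask w = a] `&` [set w | delta_mask w = b].
  by apply/seteqP; split=> w /= => [[-> ->]//|[-> ->]].
rewrite (sigma_delta_indep sd (sign_in a) (delta_in b)) sign_law EFinM.
by rewrite /mask_law fineK_prob.
Qed.

(** Independence of [sigma] and [delta] makes the joint law a product, uniform in the signs. Any
    event read off the two masks is a finite union of atoms, which also yields its measurability. *)
Lemma sjlt_prb (Q : pred (mask * mask)) :
  measurable [set w | Q (sign_mask w, delta_mask w)] /\
  P [set w | Q (sign_mask w, delta_mask w)] = (prb mask_law Q)%:E.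
Proof.
have mX x : measurable [set w | (sign_mask w, delta_mask w) = x].
  case: x => a b.
  have -> : [set w | (sign_mask w, delta_mask w) = (a, b)] =
      [set w | sign_mask w = a] `&` [set w | delta_mask w = b].
    by apply/seteqP; split=> w /= => [[-> ->]//|[-> ->]].
  apply: measurableI => //; exact: sigma_algebra_of_measurable (sign_in a).
have [mQ ->] := prob_finite_law P Q mX; split => //; congr EFin.
rewrite (eq_bigr (fun x => 2 ^- (m * n) * mask_law x.2)) => [|[a b] _]; last first.
  by rewrite joint_law.
pose f (a b : mask) := if Q (a, b) then 2 ^- (m * n) * mask_law b else 0.
rewrite big_mkcond (eq_bigr (fun x => f x.1 x.2)) => [|[a b] _//].
rewrite -(pair_bigA _ f)/= exchange_big/=.
apply: eq_bigr => b _; rewrite -big_mkcond/= sumr_const -[LHS]mulr_natl.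
by rewrite cardsE mulrA mulrC.
Qed.

(** Union bound over the possible supports inside [R0]; the moment hypothesis bounds the probability
    of each, as the product of the entries is the indicator of that support being full. *)
Let column_subset_law (R0 : {set 'I_m}) j :
  (P [set w | forall i, (if i \in R0 then setT else delta i j @^-1` [set 0%R]) w]
    <= ('C(#|R0|, s)%:R * (s%:R / m%:R) ^+ s)%:E)%E.
Proof.
have ones (S0 : {set 'I_m}) : #|S0| = s ->
    \sum_(b : mask | [forall i in S0, b (i, j)]) mask_law b <= (s%:R / m%:R) ^+ s.
  move=> S0s; pose E := [set w | [forall i in S0, delta_mask w (i, j)]].
  have [mE PE] := prob_finite_law P (fun b : mask => [forall i in S0, b (i, j)]) mD.
  have := delta_moment sd j S0; rewrite -/E in mE PE.
  have -> : (fun w => \prod_(i in S0) delta i j w) = \1_E.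
    apply/funext => w; rewrite indicE.
    case: (boolP (w \in E)) => [|].
      rewrite inE => /forallP h; rewrite big1// => i iS.
      by have /implyP/(_ iS) := h i; rewrite ffunE => /eqP.
    rewrite notin_setE /E/= => /negP; rewrite negb_forall => /existsP[i].
    rewrite negb_imply ffunE/= => /andP[iS d1]; rewrite (bigD1 i)//=.
    have [->|d1'] := (delta_01 sd) i j w; first by rewrite mul0r.
    by rewrite d1' eqxx in d1.
  by rewrite expectation_indic// PE lee_fin S0s.
pose QA (b : mask) := [forall i, (i \in R0) || ~~ b (i, j)].
have -> : [set w | forall i, (if i \in R0 then setT else delta i j @^-1` [set 0]) w] =
    [set w | QA (delta_mask w)].
  apply/seteqP; split=> w /=.
    move=> h; apply/forallP => i; have := h i; case: ifPn => //= iR d0.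
    by rewrite ffunE/= d0 lt_eqF// ltr01.
  move=> /forallP h i; have := h i; case: ifPn => //= iR; rewrite ffunE/=.
  by have [->//|->] := (delta_01 sd) i j w; rewrite eqxx.
have [_ ->] := prob_finite_law P QA mD; rewrite lee_fin.
apply: (@le_trans _ _ (\sum_(S0 : {set 'I_m} | (S0 \subset R0) && (#|S0| == s))
    \sum_(b : mask | [forall i in S0, b (i, j)]) mask_law b)); last first.
  rewrite (le_trans (ler_sum _ (fun S0 h => ones S0 (eqP (andP h).2))))//.
  rewrite sumr_const -[leLHS]mulr_natl ler_wpM2r ?exprn_ge0 ?divr_ge0//.
  by rewrite ler_nat -cards_draws cardsE.
rewrite (exchange_big_dep xpredT)//= big_mkcond/=.
apply: ler_sum => b _; case: ifPn => [Qb|_]; last first.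
  by apply: sumr_ge0 => S0 _; exact: mask_law_ge0.
(* Exact column sparsity is known only for masks that some outcome attains; the others have law
   zero. *)
have [[w bw]|nw] := pselect (exists w, delta_mask w = b); last first.
  rewrite (_ : fine _ = 0); last first.
    rewrite (_ : [set w | _] = set0) ?measure0//; apply/seteqP; split => // w bw.
    by apply: nw; exists w.
  by apply: sumr_ge0 => S0 _; exact: mask_law_ge0.
pose S0 : {set 'I_m} := [set i | b (i, j)]%SET.
rewrite (bigD1 S0)/=; last first.
  apply/andP; split; [apply/andP; split|].
  - apply/fintype.subsetP => i; rewrite inE => bij.
    by have /forallP/(_ i) := Qb; rewrite bij orbF.
  - rewrite -(delta_column_sparsity sd j w); apply/eqP; congr (#|pred_of_set _|).
    by apply/setP => i; rewrite !inE -bw ffunE.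
  - by apply/forallP => i; apply/implyP; rewrite inE.
by rewrite lerDl sumr_ge0// => S1 _; exact: mask_law_ge0.
Qed.

Lemma mask_law_columns (K : {set 'I_n}) (R0 : {set 'I_m}) :
  \sum_(b : mask | [forall j in K, forall i, b (i, j) ==> (i \in R0)]) mask_law b
    <= ('C(#|R0|, s)%:R * (s%:R / m%:R) ^+ s) ^+ #|K|.
Proof.
have [_] := prob_finite_law P
  (fun b : mask => [forall j in K, forall i, b (i, j) ==> (i \in R0)]) mD.
pose A j := [set w | forall i, (if i \in R0 then setT else delta i j @^-1` [set 0]) w].
have Ain j : sigma_algebra_of (fun i => delta i j) (A j).
  apply: sigma_algebra_ofI => i; case: ifP => _; first exact: sigma_algebra_ofT.
  exact: (@in_sigma_algebra_of _ (fun i => delta i j)).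
have -> : [set w | [forall j in K, forall i, delta_mask w (i, j) ==> (i \in R0)]] =
    \bigcap_(j in [set` K]) A j.
  apply/seteqP; split=> w /=.
    move=> /forallP h j /= jK i; case: ifPn => // iR.
    have /implyP/(_ jK)/forallP/(_ i) := h j; rewrite ffunE/= (negbTE iR) implybF.
    by have [->//|->] := (delta_01 sd) i j w; rewrite eqxx.
  move=> h; apply/forallP => j; apply/implyP => jK; apply/forallP => i.
  apply/implyP; rewrite ffunE/=; have := h j jK i; case: ifPn => // iR /= ->.
  by rewrite lt_eqF// ltr01.
rewrite (delta_columns_indep sd); last by move=> j _; exact: Ain.
have mA j : measurable (A j) by exact: sigma_algebra_of_measurable (Ain j).
rewrite (eq_bigr (fun j => (fine (P (A j)))%:E)) => [|j _]; last first.
  by rewrite fineK_prob.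
rewrite prod_EFin => -[<-]; rewrite -prodr_const; apply: ler_prod => j _.
by rewrite fine_ge0//= -lee_fin fineK_prob// column_subset_law.
Qed.

End SjltLaw.

(** * Rounding a vector to a sparse integer vector *)

Section Rowsum.
Context {R : realType} {m n : nat}.
Implicit Types (a b : {ffun 'I_m * 'I_n -> bool}) (v : 'I_n -> R).

Lemma rowsumZ a b c v i : rowsum a b (fun j => c * v j) i = c * rowsum a b v i.
Proof. by rewrite /rowsum mulr_sumr; apply: eq_bigr => j _; ring. Qed.

Lemma rowsum_dist a b v v' e i : (forall j, `|v j - v' j| <= e) ->
  `|rowsum a b v i| <= `|rowsum a b v' i| + n%:R * e.
Proof.
move=> ve; rewrite -{1}(subrK (rowsum a b v' i) (rowsum a b v i)).
rewrite (le_trans (ler_normD _ _))// addrC lerD2l /rowsum -sumrB.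
rewrite (le_trans (ler_norm_sum _ _ _))//.
rewrite mulr_natl -[n in _ *+ n]card_ord -sumr_const; apply: ler_sum => j _.
rewrite -mulrBr !normrM normrX normrN1 expr1n mul1r (le_trans _ (ve j))//.
by rewrite ler_piMl//; case: (b _); rewrite ?normr1 ?normr0.
Qed.

Lemma dyadic_levels (N : nat -> nat) J : (0 < N 0)%N ->
  (exists2 j, (j < J)%N & (2 ^ j <= N j)%N /\ (N j.+1 < 2 ^ j.+1)%N) \/
  (2 ^ J <= N J)%N.
Proof.
move=> N0; elim: J => [|J [[j jJ h]|h]]; first by right.
  by left; exists j => //; rewrite ltnS ltnW.
by case: (leqP (2 ^ J.+1) (N J.+1)) => h'; [right|left; exists J].
Qed.

(** Truncation towards zero, with the integers from [-Q] to [Q] stored shifted by [Q]. Entries below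
    1 vanish, which gives sparsity, and integer lower bounds survive, which keeps large coordinates
    large. *)
Lemma digit_approx (Q : nat) (x : R) : `|x| <= Q%:R ->
  exists e : 'I_(2 * Q).+1, let z := e%:R - Q%:R in
    [/\ `|x - z| <= 1, `|x| < 1 -> z = 0 &
      forall h : nat, h%:R <= `|x| -> h%:R <= `|z|].
Proof.
move=> xQ; pose t := Num.truncn `|x|.
have /andP[tx xt] : t%:R <= `|x| < t.+1%:R by apply: truncn_itv.
have tQ : (t <= Q)%N by rewrite -(ler_nat R) (le_trans tx).
have z0 : `|x| < 1 -> t = 0%N.
  by move=> x1; apply/eqP; rewrite -leqn0 -ltnS -(ltr_nat R) (le_lt_trans tx).
have zh (h : nat) : h%:R <= `|x| -> (h <= t)%N.
  by move=> hx; rewrite -ltnS -(ltr_nat R) (le_lt_trans hx).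
rewrite -natr1 in xt.
have [x0|x0] := leP 0 x.
  have h1 : (Q + t < (2 * Q).+1)%N by lia.
  exists (Ordinal h1) => /=; rewrite natrD [_ + t%:R]addrC addrK.
  rewrite (ger0_norm x0) in tx xt; split.
  - by rewrite ger0_norm ?subr_ge0//; lra.
  - by move=> /z0 ->.
  - by move=> h /zh; rewrite ger0_norm// ler_nat.
have h1 : (Q - t < (2 * Q).+1)%N by lia.
exists (Ordinal h1) => /=; rewrite natrB// addrAC subrr add0r.
rewrite (ltr0_norm x0) in tx xt; split.
- by rewrite opprK ler0_norm; lra.
- by move=> /z0 ->; rewrite oppr0.
- by move=> h /zh; rewrite normrN ger0_norm// ler_nat.
Qed.

(** [k] pairs of position and shifted value: the index type has [(n (2 Q + 1)) ^ k] elements, the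
    count in the union bound. If a position repeats, a single slot is read. *)
Definition sparse_vector k Q (p : {ffun 'I_k -> 'I_n * 'I_(2 * Q).+1})
    (i : 'I_n) : R :=
  if [pick t | (p t).1 == i] is Some t then (p t).2%:R - Q%:R else 0.

Lemma sparse_vectorP k Q (z : 'I_n -> 'I_(2 * Q).+1) : (0 < n)%N ->
  (#|[set i | ((z i)%:R - Q%:R != 0 :> R)%R]%SET| <= k)%N -> (0 < k)%N ->
  exists p : {ffun 'I_k -> 'I_n * 'I_(2 * Q).+1},
    forall i, sparse_vector p i = (z i)%:R - Q%:R.
Proof.
move=> n0 zk k0; set S := finset _ in zk.
(* Slots beyond the support point to the first coordinate and carry its true entry, so repeated
   positions agree. *)
pose f (t : 'I_k) := nth (Ordinal n0) (enum S) t.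
exists [ffun t => (f t, z (f t))] => i; rewrite /sparse_vector.
case: pickP => [t|h]; first by rewrite ffunE/= => /eqP ->.
apply/esym/eqP/negPn/negP => zi.
have iS : i \in enum S by rewrite mem_enum inE.
have ik : (index i (enum S) < k)%N.
  by apply: leq_trans zk; rewrite cardE index_mem.
by have := h (Ordinal ik); rewrite ffunE/= /f/= nth_index// eqxx.
Qed.

End Rowsum.

(** If [k <= m / s] the quantity to beat is [s k >= A L^2 k]; otherwise
    [s (m %/ s) >= m / 2 >= A L^2 k / 4]. In both cases each of the two terms on the left, times 64,
    takes at most half. *)
Lemma exponent_budget (c1 A L k d s m : nat) : (0 < s <= m)%N -> (0 < k)%N ->
  (k <= 2 * d)%N -> (A * L ^ 2 <= s)%N -> (A * d * L ^ 2 <= m)%N ->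
  (512 * c1.+1 <= A)%N ->
  (c1 * (L ^ 2 * k) + s %/ 256 <= (s * minn k (m %/ s)) %/ 64)%N.
Proof.
move=> /andP[s0 sm] k0 kd As Am cA; rewrite leq_divRL//.
set X := (L ^ 2)%N in As Am *.
have hs : (s %/ 256 * 256 <= s)%N by rewrite leq_trunc_div.
have [km|mk] := leqP k (m %/ s).
  have h1 : (A * X * k <= s * k)%N by rewrite leq_mul2r As orbT.
  have h2 : (512 * c1.+1 * (X * k) <= A * (X * k))%N by rewrite leq_mul2r cA orbT.
  have h3 : (s <= s * k)%N by rewrite leq_pmulr.
  rewrite mulnDl; move: h1 h2 h3; set Y := (X * k)%N; set Z := (s * k)%N.
  rewrite -mulnA -/Y => h1 h2 h3; nia.
have hm : (m <= 2 * (s * (m %/ s)))%N.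
  have := divn_eq m s; have := ltn_pmod m s0.
  have : (0 < m %/ s)%N by rewrite divn_gt0.
  by move=> h1 h2 h3; nia.
have h1 : (512 * c1.+1 * (d * X) <= A * (d * X))%N by rewrite leq_mul2r cA orbT.
have h2 : (X * k <= 2 * (d * X))%N by rewrite mulnA mulnC leq_mul2r kd orbT.
rewrite -mulnA in Am; rewrite mulnDl.
move: h1 h2 hm Am; set Y := (X * k)%N; set Z := (d * X)%N.
set W := (s * _)%N => h1 h2 hm Am; nia.
Qed.

(** * A finite net of the ball and the sup norm of a vector *)

Section BallNet.
Context {R : realType}.

(** Grid cells of side [1 / H]. The hypotheses on [F] hold only in the ball, so each cell meeting
    the ball is represented by one of its points there instead of its centre; other cells get
    [0]. *)
Lemma l2ball_net d (H : nat) : (0 < H)%N ->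
  exists rep : {ffun 'I_d -> 'I_(2 * H).+1} -> 'cV[R]_d,
    (forall c, l2ball R d (rep c)) /\
    forall x, l2ball R d x -> exists c, forall i, `|x i 0 - rep c i 0| <= H%:R^-1.
Proof.
move=> H0; have H0' : 0 < H%:R :> R by rewrite ltr0n.
pose idx (x : 'cV[R]_d) i : 'I_(2 * H).+1 := inord (Num.truncn ((x i 0 + 1) * H%:R)).
pose cell x : {ffun 'I_d -> 'I_(2 * H).+1} := [ffun i => idx x i].
have /choice[rep repP] : forall c, exists y, l2ball R d y /\
    ((exists2 x, l2ball R d x & cell x = c) -> cell y = c).
  move=> c; have [[x Bx xc]|nx] := pselect (exists2 x, l2ball R d x & cell x = c).
    by exists x.
  by exists 0; split => //; rewrite /l2ball/= l2norm0.
exists rep; split => [c|x Bx]; first by have [] := repP c.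
exists (cell x) => i; have [Br rc] := repP (cell x).
have {}rc : cell (rep (cell x)) = cell x by apply: rc; exists x.
have idxP y : l2ball R d y -> (idx y i)%:R <= (y i 0 + 1) * H%:R < (idx y i)%:R + 1.
  move=> By; have := le_trans (ler_coord_l2norm y i) By.
  rewrite ler_norml => /andP[y1 y2].
  have y0 : 0 <= (y i 0 + 1) * H%:R by rewrite mulr_ge0//; lra.
  have /andP[t1 t2] := truncn_itv y0.
  rewrite /idx inordK; first by rewrite t1 natr1.
  rewrite ltnS -(ler_nat R) (le_trans t1)// natrM ler_wpM2r//; lra.
have := idxP _ Bx; have := idxP _ Br.
have -> : idx (rep (cell x)) i = idx x i.
  by have := congr1 (fun f : {ffun _} => f i) rc; rewrite !ffunE.
move=> /andP[h1 h2] /andP[h3 h4].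
rewrite -(ler_pM2r H0') mulVf ?gt_eqF// -[X in _ * X](gtr0_norm H0') -normrM.
by rewrite ler_norml; apply/andP; split; lra.
Qed.

Lemma sup_coord n (v : 'I_n -> R) (i : 'I_n) : v i != 0 ->
  exists2 mu, 0 < mu & (forall j, `|v j| <= mu) /\ exists j, `|v j| = mu.
Proof.
move=> vi.
case: (@Order.TotalTheory.arg_maxP _ R 'I_n i xpredT (fun j => `|v j|)) => //.
move=> k _ kP.
exists `|v k|; last by split => [j|]; [exact: kP|exists k].
by rewrite (lt_le_trans _ (kP i isT))// normr_gt0.
Qed.

End BallNet.

(** * Union bound over all long chords *)

Section UnionBound.
Context {R : realType}.
Variables (m n s : nat).
Notation mask := {ffun 'I_m * 'I_n -> bool}.
Variable q : mask -> R.
Hypothesis s_gt0 : (0 < s)%N.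
Hypothesis q_ge0 : forall b, 0 <= q b.
Hypothesis q_sum1 : \sum_b q b = 1.
Hypothesis q_columns : forall (K : {set 'I_n}) (R0 : {set 'I_m}),
  \sum_(b : mask | [forall j in K, forall i, b (i, j) ==> (i \in R0)]) q b
    <= ('C(#|R0|, s)%:R * (s%:R / m%:R) ^+ s) ^+ #|K|.

Definition bad_family (I : finType) (V : I -> 'I_n -> R) (tau : R) k
    (x : mask * mask) : bool :=
  [exists c, (k <= #|[set i | (tau < `|V c i|)%R]%SET|)%N && small_rows (V c) tau x].

Lemma prb_bad_family (I : finType) (V : I -> 'I_n -> R) (tau : R) k :
  prb q (bad_family V tau k) <=
    #|I|%:R * (2 * 2 ^- ((s * minn k (m %/ s)) %/ 64)).
Proof.
apply: (le_trans (prb_union q_ge0 _ _)) => /=.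
apply: (@le_trans _ _ (\sum_(c | (k <= #|[set i | (tau < `|V c i|)%R]%SET|)%N)
    (2 * 2 ^- ((s * minn k (m %/ s)) %/ 64)))).
  apply: ler_sum => c kc; apply: prb_small_rows kc => // j.
  by rewrite inE.
rewrite sumr_const -[leLHS]mulr_natl ler_wpM2r//.
by rewrite ler_nat max_card.
Qed.

Let h := n.+1.

(** The threshold [n + 1/2] allows [n] for the rounding errors in a row and [1/2] for the row of the
    scaled chord. It lies below [h = n + 1], the size kept by large coordinates after rounding. *)
Definition bad_sparse j : pred (mask * mask) :=
  bad_family (@sparse_vector R n (2 ^ j.+1) (h ^ j.+1)) (n%:R + 2^-1) (2 ^ j).

(** Scaling by [Q / mu] puts all entries in the range from [-Q] to [Q]. Entries smaller than
    [mu / h^(j+1)] round to 0, and entries at least [mu / h^j] stay at least [h]. *)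
Lemma bad_sparseI (x : mask * mask) (v : 'I_n -> R) mu j : (0 < n)%N ->
  0 < mu -> (forall i, `|v i| <= mu) ->
  (2 ^ j <= #|[set i | (mu <= `|v i| * (h ^ j)%:R)%R]%SET|)%N ->
  (#|[set i | (mu <= `|v i| * (h ^ j.+1)%:R)%R]%SET| < 2 ^ j.+1)%N ->
  (forall i, `|rowsum x.1 x.2 v i| <= mu / (2 * (h ^ j.+1)%:R)) ->
  bad_sparse j x.
Proof.
move=> n0 mu0 vmu N1 N2 rows.
set Q := (h ^ j.+1)%N in N2 rows *.
have Q0 : 0 < Q%:R :> R by rewrite ltr0n expn_gt0.
pose y i := Q%:R / mu * v i.
have ny i : `|y i| = Q%:R / mu * `|v i|.
  by rewrite normrM gtr0_norm// divr_gt0.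
have /choice[z zP] : forall i, exists e : 'I_(2 * Q).+1, let z := e%:R - Q%:R in
    [/\ `|y i - z| <= 1, `|y i| < 1 -> z = 0 &
      forall k : nat, k%:R <= `|y i| -> k%:R <= `|z|].
  move=> i; apply: digit_approx; rewrite ny mulrAC ler_pdivrMr//.
  by rewrite ler_pM2l.
have [||p pz] := @sparse_vectorP R n (2 ^ j.+1) Q z n0.
- apply: leq_trans (ltnW N2); apply: subset_leq_card.
  apply/fintype.subsetP => i; rewrite !inE; apply: contraR; rewrite -ltNge => lt.
  have [_ + _] := zP i; move=> ->//; rewrite ny mulrAC ltr_pdivrMr// mul1r.
  by rewrite mulrC.
- by rewrite expn_gt0.
apply/existsP; exists p; apply/andP; split.
  apply: leq_trans N1 _; apply: subset_leq_card.
  apply/fintype.subsetP => i; rewrite !inE pz => le1.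
  have [_ _ /(_ h)] := zP i; rewrite ny mulrAC ler_pdivlMr// => hz.
  have : h%:R <= `|(z i)%:R - Q%:R : R|.
    apply: hz; rewrite /Q expnS natrM -mulrA ler_wpM2l// mulrC//.
  by rewrite /h -natr1; lra.
apply/forallP => i; have e1 : forall k, `|sparse_vector p k - y k| <= 1 :> R.
  by move=> k; rewrite pz distrC; have [] := zP k.
rewrite (le_trans (rowsum_dist x.1 x.2 i e1))// mulr1 addrC lerD2l.
rewrite rowsumZ normrM gtr0_norm ?divr_gt0//.
rewrite (le_trans (ler_wpM2l _ (rows i)))//; first by rewrite divr_ge0 ?ltW.
rewrite le_eqVlt; apply/orP; left; apply/eqP; field.
by rewrite ?gt_eqF.
Qed.

(** The exponent [l] pays for the family size [2 ^ C], the factor 2, the number [2 ^ L'] of families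
    and the final probability [2 ^- t]. *)
Let union_term (N C l L' t : nat) : (N <= 2 ^ C)%N -> (C + 1 + L' + t <= l)%N ->
  N%:R * (2 * 2 ^- l) <= 2 ^- L' * 2 ^- t :> R.
Proof.
move=> NC Cl; apply: (@le_trans _ _ (2 ^+ C * (2 * 2 ^- (C + 1 + L' + t)))).
  apply: ler_pM => //; first by rewrite -natrX ler_nat.
  by rewrite ler_wpM2l// lef_pV2 ?posrE ?exprn_gt0// ler_weXn2l// ler1n.
rewrite !exprD expr1 le_eqVlt; apply/orP; left; apply/eqP; field.
by rewrite !expf_neq0.
Qed.

Let union_exponent (C c X L t : nat) : (0 < L)%N -> (C + 2 <= c)%N -> (L <= X)%N ->
  (C * X + 1 + L + t <= c * X + t)%N.
Proof. by move=> L0 Cc LX; nia. Qed.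

(** Each of the [2^(j+1)] slots takes at most [5 L^2] bits. *)
Let sparse_count (L j : nat) : (1 < n)%N -> (n <= 2 ^ L)%N -> (j < L)%N ->
  (#|{ffun 'I_(2 ^ j.+1) -> 'I_n * 'I_(2 * h ^ j.+1).+1}| <=
    2 ^ (10 * (L ^ 2 * 2 ^ j)))%N.
Proof.
move=> n1 nL jL; rewrite card_ffun card_prod !card_ord.
have hL : (h <= 2 ^ (2 * L))%N.
  apply: (@leq_trans (2 ^ L * 2 ^ 1)); last by rewrite -expnD leq_exp2l//; lia.
  by rewrite /h; lia.
have QL : (h ^ j.+1 <= 2 ^ (2 * L * j.+1))%N by rewrite expnM leq_exp2r.
have Q0 : (0 < 2 ^ (2 * L * j.+1))%N by rewrite expn_gt0.
have h1 : (n * (2 * h ^ j.+1).+1 <= 2 ^ L * 2 ^ (2 * L * j.+1 + 2))%N.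
  by apply: leq_mul => //; rewrite expnD; lia.
rewrite -expnD in h1.
apply: (@leq_trans ((2 ^ (L + (2 * L * j.+1 + 2))) ^ (2 ^ j.+1))).
  by rewrite leq_exp2r// expn_gt0.
rewrite -expnM leq_exp2l// expnS.
have : (L + (2 * L * j.+1 + 2) <= 5 * L ^ 2)%N by rewrite expnS expn1; nia.
move: (2 ^ j)%N (L ^ 2)%N => k X hX; nia.
Qed.

(** [h ^ J] is the only factor quasi-polynomial in [n], with exponent [2 L^2]; the others give
    [3 + 4 a + 5 L]. *)
Let net_fineness (a L d J : nat) : (1 < n)%N -> (n <= 2 ^ L)%N -> (d <= n)%N ->
  (J <= L)%N ->
  (8 * 2 ^ (4 * a) * d * n ^ 2 * (n + 2) * h ^ J < 2 ^ ((11 + 4 * a) * L ^ 2))%N.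
Proof.
move=> n1 nL dn JL.
have L0 : (0 < L)%N by case: L nL {JL} => //; rewrite expn0; lia.
have hL : (h <= 2 ^ (2 * L))%N.
  apply: (@leq_trans (2 ^ L * 2 ^ 1)); last by rewrite -expnD leq_exp2l//; lia.
  by rewrite /h; lia.
have h2 : (n + 2 <= 2 ^ (2 * L))%N.
  apply: (@leq_trans (2 ^ L * 2 ^ 1)); last by rewrite -expnD leq_exp2l//; lia.
  by lia.
have hJ : (h ^ J <= 2 ^ (2 * L * L))%N.
  apply: (@leq_trans (h ^ L)); first by rewrite leq_exp2l// /h; lia.
  by rewrite expnM leq_exp2r.
have n2 : (n ^ 2 <= 2 ^ (L * 2))%N by rewrite expnM leq_exp2r.
have dL : (d <= 2 ^ L)%N by lia.
apply: (@leq_ltn_trans (2 ^ 3 * 2 ^ (4 * a) * 2 ^ L * 2 ^ (L * 2) * 2 ^ (2 * L)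
  * 2 ^ (2 * L * L))%N).
  by do !apply: leq_mul.
rewrite -!expnD ltn_exp2l// expnS expn1; nia.
Qed.

(** A net point takes at most [(11 + 4 a) L^2 + 2] bits per coordinate, and a chord has two
    endpoints. *)
Let net_count (a L d k : nat) : (d <= k)%N -> (0 < L)%N ->
  (#|{: {ffun 'I_d -> 'I_(2 * 2 ^ ((11 + 4 * a) * L ^ 2)).+1} *
        {ffun 'I_d -> 'I_(2 * 2 ^ ((11 + 4 * a) * L ^ 2)).+1}}|
    <= 2 ^ ((26 + 8 * a) * (L ^ 2 * k)))%N.
Proof.
move=> dk L0; rewrite card_prod !card_ffun !card_ord.
set e := ((11 + 4 * a) * L ^ 2)%N.
have h1 : ((2 * 2 ^ e).+1 <= 2 ^ (e + 2))%N.
  by rewrite expnD; have : (0 < 2 ^ e)%N by [rewrite expn_gt0]; lia.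
have h2 : ((2 * 2 ^ e).+1 ^ d <= 2 ^ ((e + 2) * d))%N.
  by rewrite expnM; case: (d) => [|d']; [rewrite !expn0|rewrite leq_exp2r].
apply: (leq_trans (leq_mul h2 h2)); rewrite -expnD leq_exp2l//.
have X0 : (0 < L ^ 2)%N by rewrite expn_gt0 L0.
rewrite /e; move: (L ^ 2)%N X0 => X X0.
have h3 : (X * d <= X * k)%N by rewrite leq_mul2l dk orbT.
have h4 : (d <= X * k)%N by apply: leq_trans h3; rewrite leq_pmull.
have h5 : (a * (X * d) <= a * (X * k))%N by rewrite leq_mul2l h3 orbT.
lia.
Qed.

(** One event, chosen before the chord, controls all long chords at once. The value of [kappa] is
    not quantified: any positive lower bound makes the map expansive. *)
Lemma far_chords (d a L : nat) (F : 'cV[R]_d -> 'cV[R]_n) (c0 : R) :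
  1 <= c0 -> c0 <= (2 ^ a)%:R -> (0 < d <= n)%N -> (1 < n)%N ->
  (n <= 2 ^ L)%N -> (s <= m)%N ->
  (forall x y, l2ball R d x -> l2ball R d y ->
    c0^-1 * l2norm (x - y) <= l2norm (F x - F y) <= c0 * l2norm (x - y)) ->
  (512 * (30 + 8 * a) * L ^ 2 <= s)%N ->
  (512 * (30 + 8 * a) * d * L ^ 2 <= m)%N ->
  exists (bad : pred (mask * mask)) (kappa : R),
    [/\ 0 < kappa, prb q bad <= 2 ^- (s %/ 256) &
      forall x, ~~ bad x -> forall u v, l2ball R d u -> l2ball R d v ->
        (4 * c0 ^+ 2 * n%:R)^-1 <= l2norm (u - v) ->
        exists i, kappa < `|rowsum x.1 x.2 (fun j => (F u - F v) j 0) i|].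
Proof.
move=> c1 ca /andP[d0 dn] n1 nL sm bilip As Am.
have L0 : (0 < L)%N by case: L nL {As Am} => //; rewrite expn0; lia.
have c0_gt0 : 0 < c0 by exact: lt_le_trans c1.
(* [2 ^ J] lies between [d] and [2 d]: enough large coordinates to pay for a net of pairs in
   dimension [d], while the hypothesis on [m] still covers this many columns. *)
pose J := up_log 2 d.
have dJ : (d <= 2 ^ J)%N by exact: up_logP.
have JL : (J <= L)%N by apply: up_log_min => //; exact: leq_trans nL.
have J2d : (2 ^ J <= 2 * d)%N.
  have [d1|d1] := leqP d 1; first by rewrite /J (_ : d = 1%N) ?up_log1//; lia.
  have /andP[+ _] := up_log_bounds (isT : (1 < 2)%N) d1; rewrite -/J.
  by case: (J) => [|J'] /=; rewrite ?expn0 ?expnS; lia.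
pose H := (2 ^ ((11 + 4 * a) * L ^ 2))%N.
have H0 : (0 < H)%N by rewrite expn_gt0.
have [rep [repB repP]] := @l2ball_net R d H H0.
have n0' : 0 < n%:R :> R by rewrite ltr0n; lia.
have d0' : 0 < d%:R :> R by rewrite ltr0n.
have H0' : 0 < H%:R :> R by rewrite ltr0n.
have hJ0 : 0 < (h ^ J)%:R :> R by rewrite ltr0n expn_gt0.
(* The error in a chord when both endpoints move to the net, each by at most [d / H]. *)
pose e : R := 2 * c0 * d%:R / H%:R.
have e0 : 0 < e by rewrite divr_gt0// !mulr_gt0.
(* A lower bound for the sup norm of a long chord: its Euclidean length is at least [(4 c0^3 n)^-1],
   and the sup norm loses a factor [n]. *)
pose mu0 : R := (4 * c0 ^+ 3 * n%:R ^+ 2)^-1.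
have mu00 : 0 < mu0 by rewrite invr_gt0 !mulr_gt0// exprn_gt0.
(* A coordinate of size [mu0 / h^J] must exceed [tau = (n + 1) e] after losing [e] to the net. *)
have key : (n%:R + 2) * e < mu0 / (h ^ J)%:R.
  have c4 : c0 ^+ 4 <= (2 ^ (4 * a))%:R.
    by rewrite mulnC expnM natrX ler_pXn2r ?nnegrE ?(ltW c0_gt0).
  have kn : 8 * (2 ^ (4 * a))%:R * d%:R * n%:R ^+ 2 * (n%:R + 2) * (h ^ J)%:R < H%:R :> R.
    by rewrite -!natrX -(natrD _ n 2) -!natrM ltr_nat net_fineness.
  rewrite /e mulrA ltr_pdivrMr// [ltRHS]mulrAC ltr_pdivlMr// /mu0.
  rewrite [ltRHS]mulrC ltr_pdivlMr; last by rewrite !mulr_gt0// exprn_gt0.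
  apply: le_lt_trans kn.
  have -> : (n%:R + 2) * (2 * c0 * d%:R) * (h ^ J)%:R * (4 * c0 ^+ 3 * n%:R ^+ 2) =
    c0 ^+ 4 * (8 * d%:R * n%:R ^+ 2 * (n%:R + 2) * (h ^ J)%:R) by ring.
  have -> : 8 * (2 ^ (4 * a))%:R * d%:R * n%:R ^+ 2 * (n%:R + 2) * (h ^ J)%:R =
    (2 ^ (4 * a))%:R * (8 * d%:R * n%:R ^+ 2 * (n%:R + 2) * (h ^ J)%:R) :> R.
    by ring.
  by rewrite ler_wpM2r// !mulr_ge0// ?addr_ge0// exprn_ge0.
pose V (c : {ffun 'I_d -> 'I_(2 * H).+1} * {ffun 'I_d -> 'I_(2 * H).+1}) j :=
  (F (rep c.1) - F (rep c.2)) j 0.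
pose tau : R := (n%:R + 1) * e.
pose Qs (o : option 'I_J) : pred (mask * mask) :=
  if o is Some j then bad_sparse j else bad_family V tau (2 ^ J).
(* In the net case [tau] leaves room [e] beyond the accumulated error [n e]; in the sparse case
   [mu0 / (2 h^J)] serves every level below [J]. *)
pose kappa := Num.min e (mu0 / (2 * (h ^ J)%:R)).
exists (fun x => [exists o, xpredT o && Qs o x]), kappa; split.
- by rewrite lt_min e0 divr_gt0// mulr_gt0.
- apply: le_trans (prb_union q_ge0 _ _) _.
  (* [29 + 8 a] exceeds both counting exponents, [10] and [26 + 8 a], by the 2 that [union_exponent]
     requires. *)
  have budget k : (0 < k)%N -> (k <= 2 * d)%N ->
      ((29 + 8 * a) * (L ^ 2 * k) + s %/ 256 <= (s * minn k (m %/ s)) %/ 64)%N.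
    move=> k0 kd; apply: (exponent_budget (A := 512 * (30 + 8 * a)) (d := d)) => //.
    by rewrite s_gt0.
  have LL k : (0 < k)%N -> (L <= L ^ 2 * k)%N.
    by move=> k0; rewrite expnS expn1 -mulnA leq_pmulr// muln_gt0 L0.
  apply: (@le_trans _ _ (\sum_(o : option 'I_J) 2 ^- L * 2 ^- (s %/ 256))).
    apply: ler_sum => -[j|] _ /=; apply: (le_trans (prb_bad_family _ _ _)).
      apply: union_term (sparse_count n1 nL (leq_trans (ltn_ord j) JL)) _.
      have k0 : (0 < 2 ^ j)%N by rewrite expn_gt0.
      apply: leq_trans (budget _ k0 _); last first.
        by apply: leq_trans J2d; rewrite leq_exp2l// ltnW.
      by apply: union_exponent (LL _ k0) => //; exact: leq_trans (leq_addr _ 29).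
    have k0 : (0 < 2 ^ J)%N by rewrite expn_gt0.
    apply: union_term (net_count a dJ L0) _.
    apply: leq_trans (budget _ k0 J2d).
    by apply: union_exponent (LL _ k0) => //; rewrite addnAC leq_add2r.
  (* There are [J + 1 <= 2 ^ L] families. *)
  rewrite sumr_const card_option card_ord -[leLHS]mulr_natl mulrA.
  rewrite ler_piMl// ler_pdivrMr ?exprn_gt0// mul1r -natrX ler_nat.
  by apply: leq_trans (ltn_expl L (isT : (1 < 2)%N)); rewrite ltnS.
move=> x nbad u v Bu Bv uv; apply/not_existsP => small.
move/negP : nbad; apply.
pose w j := (F u - F v) j 0.
have lw : c0^-1 * (4 * c0 ^+ 2 * n%:R)^-1 <= l2norm (F u - F v).
  have /andP[hl _] := bilip u v Bu Bv; apply: le_trans hl.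
  by rewrite ler_pM2l ?invr_gt0.
have lw0 : 0 < l2norm (F u - F v).
  by apply: lt_le_trans lw; rewrite mulr_gt0 ?invr_gt0// !mulr_gt0// exprn_gt0.
have [i wi] : exists i, w i != 0.
  apply/not_existsP => w0; have := @l2norm_le_coord _ _ (F u - F v) 0.
  rewrite mulr0 leNgt lw0 => /(_ _)/negP; apply => // i.
  by rewrite normr_le0; apply/negPn/negP => /(w0 i).
have [mu mu_gt0 [wmu [i0 wi0]]] := sup_coord wi.
have mu0_le : mu0 <= mu.
  have := le_trans lw (l2norm_le_coord wmu); rewrite -ler_pdivrMl//.
  apply: le_trans; rewrite le_eqVlt; apply/orP; left; apply/eqP; rewrite /mu0.
  by field; rewrite ?gt_eqF.
have {}small i1 : `|rowsum x.1 x.2 w i1| <= kappa.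
  by rewrite leNgt; apply/negP => /(small i1).
pose N j := #|[set i | (mu <= `|w i| * (h ^ j)%:R)%R]%SET|.
have N0 : (0 < N 0)%N.
  by apply/card_gt0P; exists i0; rewrite inE wi0 expn0 mulr1.
have [[j jJ [N1 N2]]|NJ] := dyadic_levels J N0; apply/existsP.
  exists (Some (Ordinal jJ)) => /=; apply: (@bad_sparseI x w mu) => //.
    exact: ltnW.
  move=> i1; apply: (le_trans (small i1)); rewrite ge_min; apply/orP; right.
  apply: ler_pM => //; first exact: ltW.
  rewrite lef_pV2 ?posrE ?mulr_gt0 ?ltr0n ?expn_gt0// ler_pM2l// ler_nat.
  by rewrite leq_exp2l // ltnS ltnW.
exists None => /=; apply/existsP.
have [cu cuP] := repP u Bu; have [cv cvP] := repP v Bv; exists (cu, cv).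
have near_rep y c : l2ball R d y -> (forall i, `|y i 0 - rep c i 0| <= H%:R^-1) ->
    l2norm (F y - F (rep c)) <= e / 2.
  move=> By yc; have /andP[_ h2] := bilip y (rep c) By (repB c).
  apply: (le_trans h2).
  have h3 : l2norm (y - rep c) <= d%:R * H%:R^-1.
    by apply: l2norm_le_coord => i1; rewrite !mxE.
  apply: (le_trans (ler_wpM2l (ltW c0_gt0) h3)).
  by rewrite /e le_eqVlt; apply/orP; left; apply/eqP; field; rewrite gt_eqF.
have wV i1 : `|V (cu, cv) i1 - w i1| <= e.
  have -> : V (cu, cv) i1 - w i1 =
      (F v - F (rep cv)) i1 0 - (F u - F (rep cu)) i1 0.
    by rewrite /V /w !mxE/=; ring.
  apply: (le_trans (ler_normB _ _)).
  have := le_trans (ler_coord_l2norm _ i1) (near_rep u cu Bu cuP).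
  have := le_trans (ler_coord_l2norm _ i1) (near_rep v cv Bv cvP).
  lra.
apply/andP; split.
  apply: (leq_trans NJ); apply: subset_leq_card; apply/fintype.subsetP => i1.
  rewrite !inE => le1.
  have h1 : mu0 / (h ^ J)%:R <= `|w i1|.
    by rewrite ler_pdivrMr// (le_trans mu0_le).
  have h2 : `|w i1| <= `|V (cu, cv) i1| + e.
    rewrite -{1}(subrK (V (cu, cv) i1) (w i1)) (le_trans (ler_normD _ _))//.
    by rewrite addrC lerD2l distrC.
  by rewrite /tau; lra.
apply/forallP => i1; rewrite (le_trans (rowsum_dist _ _ i1 wV))//.
rewrite /tau mulrDl mul1r addrC lerD2l (le_trans (small i1))//.
by rewrite ge_min lexx.
Qed.

End UnionBound.

(** * Numerical constants *)

Section Constants.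
Context {R : realType}.

Lemma ln2_ge_half : 2^-1 <= ln 2 :> R.
Proof.
rewrite -[leLHS]expRK ler_ln ?posrE ?expR_gt0//.
have := expR_ge1Dx (- 2^-1 : R); rewrite expRN => h2.
rewrite -(invrK (expR _)) -[leRHS]invrK lef_pV2 ?posrE ?invr_gt0 ?expR_gt0//.
lra.
Qed.

(** The ceiling costs at most [1 <= 2 ln n], and [log_2 n <= 2 ln n]; both come from
    [ln 2 >= 1/2]. *)
Lemma up_log2_le_ln (n : nat) : (1 < n)%N -> (up_log 2 n)%:R <= 4 * ln n%:R :> R.
Proof.
move=> n1; have /andP[+ _] := up_log_bounds (isT : (1 < 2)%N) n1.
have n0 : 0 < n%:R :> R by rewrite ltr0n; lia.
have h1 : ln 2 <= ln n%:R :> R by rewrite ler_ln ?posrE// ler_nat.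
have h2 := ln2_ge_half.
case: (up_log 2 n) => [_|l /= lt_n]; first by lra.
have h3 : l%:R * ln 2 <= ln n%:R :> R.
  rewrite mulr_natl -lnXn// -natrX ler_ln ?posrE// ?ltr0n ?expn_gt0//.
  by rewrite ler_nat ltnW.
have : l%:R * 2^-1 <= l%:R * ln 2 :> R by rewrite ler_wpM2l.
by rewrite -(natr1 l); lra.
Qed.

(** For [s >= 256] the integer quotient is at least [s / 512], and [ln 2 >= 1/2], whence [1024]. *)
Lemma pow2_div256_le_expR (s : nat) : (256 <= s)%N ->
  2 ^- (s %/ 256) <= expR (- (1024^-1 * s%:R)) :> R.
Proof.
move=> s256; set t := (s %/ 256)%N.
have st : (s <= 512 * t)%N.
  have := divn_eq s 256; have := ltn_pmod s (isT : (0 < 256)%N).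
  have : (0 < t)%N by rewrite divn_gt0.
  rewrite -/t; lia.
have -> : 2 ^- t = expR (- (t%:R * ln 2)) :> R.
  by rewrite expRN expRM_natl lnK ?posrE.
rewrite ler_expR lerN2.
have h1 : t%:R * 2^-1 <= t%:R * ln 2 :> R by rewrite ler_wpM2l// ln2_ge_half.
have h2 : s%:R <= 512 * t%:R :> R by rewrite -natrM ler_nat.
lra.
Qed.

End Constants.

(** * The SJLT as a matrix determined by its masks *)

Section SjltMatrix.
Context {R : realType} {disp : measure_display} {T : measurableType disp}.
Variables (P : probability T R) (m n s : nat).
Variables sigma delta : 'I_m -> 'I_n -> {RV P >-> R}.
Hypothesis sd : sjlt_factors s sigma delta.
Hypothesis s_gt0 : (0 < s)%N.
Variable Phi : T -> 'M[R]_(m, n).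
Hypothesis PhiE :
  forall w i j, Phi w i j = (Num.sqrt s%:R)^-1 * sigma i j w * delta i j w.

Let s0 : 0 < s%:R :> R. Proof. by rewrite ltr0n. Qed.

Definition mask_matrix (x : {ffun 'I_m * 'I_n -> bool} * {ffun 'I_m * 'I_n -> bool}) :
    'M[R]_(m, n) :=
  \matrix_(i, j) ((Num.sqrt s%:R)^-1 * ((-1) ^+ x.1 (i, j) * (x.2 (i, j))%:R)).

Lemma sjlt_mask_matrix w : Phi w = mask_matrix (sign_mask sigma w, delta_mask delta w).
Proof.
apply/matrixP => i j; rewrite PhiE mxE !ffunE/= -mulrA; congr (_ * (_ * _)).
  have [h _ _] := sigma_rademacher sd i j.
  case: eqP => [->|ne]; first by rewrite expr1.
  by have [->//|] := h w.
by have [->|->] := (delta_01 sd) i j w; rewrite ?eqxx// lt_eqF// ltr01.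
Qed.

Lemma mask_matrix_mul x (v : 'cV[R]_n) i :
  (mask_matrix x *m v) i 0 =
  (Num.sqrt s%:R)^-1 * rowsum x.1 x.2 (fun j => v j 0) i.
Proof.
rewrite mxE /rowsum mulr_sumr; apply: eq_bigr => j _; rewrite mxE.
by rewrite !mulrA.
Qed.

Lemma sjlt_column w j : \sum_i Phi w i j ^+ 2 = 1.
Proof.
rewrite (eq_bigr (fun i => if delta i j w == 1 then s%:R^-1 else 0)) => [|i _].
  rewrite -big_mkcond/= sumr_const.
  have := delta_column_sparsity sd j w; rewrite cardsE => ->.
  by rewrite -[LHS]mulr_natl mulfV// gt_eqF.
rewrite PhiE.
have [->|->] := (delta_01 sd) i j w.
  by rewrite mulr0 expr0n/= lt_eqF// ltr01.
have [h _ _] := sigma_rademacher sd i j.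
rewrite mulr1 exprMn exprVn sqr_sqrtr ?ler0n// eqxx.
by have [->|->] := h w; rewrite ?sqrrN expr1n mulr1.
Qed.

Lemma frob_sjlt w : (0 < n)%N -> frob (Phi w) <= n%:R.
Proof.
move=> n0; rewrite /frob exchange_big/= (eq_bigr (fun=> 1)) => [|j _]; last first.
  exact: sjlt_column.
rewrite sumr_const card_ord -[leRHS]ger0_norm// -sqrtr_sqr ler_wsqrtr//.
by rewrite -natrX ler_nat expnS expn1 leq_pmulr.
Qed.

(** When [n = 1] the logarithms vanish and the size hypotheses say nothing, but [Phi] is then a
    single unit column. *)
Lemma sjlt_one_column w (v : 'cV[R]_n) : n = 1%N ->
  l2norm (Phi w *m v) = l2norm v.
Proof.
move=> n1; rewrite /l2norm; congr Num.sqrt.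
have h j : j = cast_ord (esym n1) ord0.
  by apply: val_inj; case: j => -[|j]//= jn; exfalso; lia.
have sumn (f : 'I_n -> R) : \sum_j f j = f (cast_ord (esym n1) ord0).
  rewrite (bigD1 (cast_ord (esym n1) ord0))//= big1 ?addr0// => j.
  by rewrite [X in X != _](h j) eqxx.
rewrite sumn (eq_bigr (fun i => Phi w i (cast_ord (esym n1) ord0) ^+ 2 *
    v (cast_ord (esym n1) ord0) 0 ^+ 2)) => [|i _].
  by rewrite -mulr_suml sjlt_column mul1r.
by rewrite mxE sumn exprMn.
Qed.

Lemma sjlt_sparsity_le : (0 < n)%N -> (s <= m)%N.
Proof.
(* The sparsity identity is read off at an arbitrary outcome. *)
move=> n0; rewrite -(delta_column_sparsity sd (Ordinal n0) point).
by rewrite -[leqRHS]card_ord max_card.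
Qed.

End SjltMatrix.

(** * From long and short chords to preserved geodesic distances *)

Section Assembly.
Context {R : realType}.
Variables (d n m : nat) (F : 'cV[R]_d -> 'cV[R]_n) (c0 eps : R).
Notation B := (l2ball R d).
Hypothesis c0_ge1 : 1 <= c0.
Hypothesis smoothF : smooth_on B F.
Hypothesis bilipF : forall x y, B x -> B y ->
  c0^-1 * l2norm (x - y) <= l2norm (F x - F y) <= c0 * l2norm (x - y).
Hypothesis lipdF : forall x y, B x -> B y ->
  l2opnorm (fun v => 'd F x v - 'd F y v) <= c0 * l2norm (x - y).
Hypothesis eps01 : 0 < eps < 2^-1.

Definition preserves_geodesics (Phi : 'M[R]_(m, n)) : Prop :=
  (forall v, unit_tangent F v -> 1 - eps <= l2norm (Phi *m v) <= 1 + eps) ->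
  forall x y, (F @` B) x -> (F @` B) y ->
    ((1 - eps)%:E * geodesic_dist (F @` B) x y
       <= geodesic_dist (mulmx Phi @` (F @` B)) (Phi *m x) (Phi *m y)
       <= (1 + eps)%:E * geodesic_dist (F @` B) x y)%E.

Lemma preserves_geodesics_expansive (Phi : 'M[R]_(m, n)) :
  (exists2 c, 0 < c & forall x y, B x -> B y ->
    c * l2norm (x - y) <= l2norm (Phi *m F x - Phi *m F y)) ->
  preserves_geodesics Phi.
Proof.
move=> inj tg x y Mx My; apply/andP; split.
  exact: (geodesic_ge c0_ge1).
exact: (geodesic_le c0_ge1).
Qed.

(** Short chords are handled by [near_pairs_expansive]. The ball has diameter 2, so the lower bound
    [kappa] on long chords is at least [kappa / 2] times their length in the ball. *)
Lemma preserves_geodesics_far (Phi : 'M[R]_(m, n)) kappa : (0 < n)%N ->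
  frob Phi <= n%:R -> 0 < kappa ->
  (forall x y, B x -> B y -> (4 * c0 ^+ 2 * n%:R)^-1 <= l2norm (x - y) ->
    kappa <= l2norm (Phi *m F x - Phi *m F y)) ->
  preserves_geodesics Phi.
Proof.
move=> n0 fn k0 far tg.
apply: (preserves_geodesics_expansive _ tg).
have c0_gt0 : 0 < c0 by exact: lt_le_trans c0_ge1.
exists (Num.min (kappa / 2) (4 * c0)^-1).
  by rewrite lt_min divr_gt0//= invr_gt0 mulr_gt0.
move=> x y Bx By.
have [xy|xy] := leP (4 * c0 ^+ 2 * n%:R)^-1 (l2norm (x - y)).
  apply: le_trans (far x y Bx By xy).
  have xy2 : l2norm (x - y) <= 2.
    rewrite (le_trans (ler_l2normB _ _))//; move: Bx By; rewrite /l2ball/=; lra.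
  apply: (@le_trans _ _ (kappa / 2 * 2)); last by rewrite divfK.
  apply: ler_pM; rewrite ?l2norm_ge0//.
    by rewrite le_min !ltW ?invr_gt0 ?divr_gt0 ?mulr_gt0.
  by rewrite ge_min lexx.
have := near_pairs_expansive c0_ge1 smoothF bilipF lipdF eps01 tg n0 fn Bx By (ltW xy).
apply: le_trans.
by rewrite ler_wpM2r ?l2norm_ge0// ge_min lexx orbT.
Qed.

End Assembly.

(** * Choice of constants, degenerate cases and conclusion *)

Theorem theorem8p8 (R : realType) (c0 : R) (hc0 : 1 <= c0) :
  exists C c : R, 0 < C /\ 0 < c /\
  forall (d n m s : nat) (F : 'cV[R]_d -> 'cV[R]_n) (eps : R)
    (disp : measure_display) (T : measurableType disp) (P : probability T R)
    (Phi : T -> 'M[R]_(m, n)),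
  let B := l2ball R d in
  let M := F @` B in
  smooth_on B F ->
  (forall x y, B x -> B y ->
     c0^-1 * l2norm (x - y) <= l2norm (F x - F y) <= c0 * l2norm (x - y)) ->
  (forall x y, B x -> B y ->
     l2opnorm (fun v => 'd F x v - 'd F y v) <= c0 * l2norm (x - y)) ->
  0 < eps < 2^-1 ->
  sjlt P s Phi ->
  C * d%:R * (ln n%:R) ^+ 2 <= m%:R ->
  C * (ln n%:R) ^+ 2 <= s%:R ->
  ((1 - expR (- (c * s%:R)))%:E <=
   P [set w : T |
       (forall v, unit_tangent F v ->
          (1 - eps <= l2norm (Phi w *m v) <= 1 + eps)%R) ->
       forall x y, M x -> M y ->
         (1 - eps)%:E * geodesic_dist M x y
           <= geodesic_dist (mulmx (Phi w) @` M) (Phi w *m x) (Phi w *m y)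
           <= (1 + eps)%:E * geodesic_dist M x y])%E.
Proof.
have [a ca] : exists a : nat, c0 <= (2 ^ a)%:R.
  exists (Num.truncn c0).+1.
  have /andP[_ /ltW h] := truncn_itv (le_trans ler01 hc0).
  by rewrite (le_trans h)// ler_nat ltnW// ltn_expl.
pose A := (512 * (30 + 8 * a))%N.
have A0 : 0 < A%:R :> R by rewrite ltr0n /A; lia.
(* The factor 16 converts [L^2], with [L] the binary logarithm rounded up, into [(ln n)^2]. [A]
   depends on [c0] only, through [a]. *)
exists (16 * A%:R), 1024^-1; split; first by rewrite mulr_gt0.
split; first by rewrite invr_gt0 ltr0n.
move=> d n m s F eps disp T P Phi B M smF bilip lipd eps01 [sigma [delta [sd PhiE]]].
move=> hm hs.
have [->|s_gt0] := posnP s.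
  by rewrite mulr0 oppr0 expR0 subrr measure_ge0.
rewrite -[X in P X]/([set w | preserves_geodesics F eps (Phi w)]).
have Pfull : (forall w, preserves_geodesics F eps (Phi w)) ->
    ((1 - expR (- (1024^-1 * s%:R)))%:E <=
      P [set w | preserves_geodesics F eps (Phi w)])%E.
  move=> h; rewrite (_ : [set w | _] = setT); last first.
    by apply/seteqP; split => // w _; exact: h.
  by rewrite probability_setT lee_fin gerBl expR_ge0.
have dn := dim_le hc0 smF bilip lipd.
(* In dimension 0 any two parameters coincide, so expansivity is trivial. *)
have [d0|d_gt0] := posnP d.
  apply: Pfull => w; apply: (preserves_geodesics_expansive hc0) => //.
  exists 1 => // x y _ _; rewrite (_ : x - y = 0) ?l2norm0 ?mulr0 ?l2norm_ge0//.
  by apply/colP => i; exfalso; case: i => i; rewrite d0.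
have n_gt0 : (0 < n)%N by exact: leq_trans dn.
have [n1|n_gt1] := leqP n 1.
  apply: Pfull => w; apply: (preserves_geodesics_expansive hc0) => //.
  exists c0^-1; first by rewrite invr_gt0 (lt_le_trans _ hc0).
  move=> x y Bx By; rewrite -mulmxBr (sjlt_one_column sd s_gt0 PhiE); last by lia.
  by have /andP[] := bilip x y Bx By.
pose L := up_log 2 n.
have nL : (n <= 2 ^ L)%N by exact: up_logP.
have L0 : (0 < L)%N by rewrite lt0n; apply: contraTneq nL => ->; rewrite -ltnNge.
have L4 : (L ^ 2)%:R <= 16 * ln n%:R ^+ 2 :> R.
  have -> : 16 * ln n%:R ^+ 2 = (4 * ln n%:R) ^+ 2 :> R by ring.
  rewrite natrX ler_pXn2r ?nnegrE//; first exact: up_log2_le_ln.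
  by rewrite mulr_ge0// ln_ge0// ler1n.
have As : (A * L ^ 2 <= s)%N.
  rewrite -(ler_nat R) (le_trans _ hs)// natrM [16 * _]mulrC -mulrA.
  by rewrite ler_pM2l.
have Am : (A * d * L ^ 2 <= m)%N.
  rewrite -(ler_nat R) (le_trans _ hm)// (natrM _ (A * d)) (natrM _ A d).
  have -> : 16 * A%:R * d%:R * ln n%:R ^+ 2 = A%:R * d%:R * (16 * ln n%:R ^+ 2) :> R.
    by ring.
  by rewrite ler_wpM2l// mulr_ge0.
have sm := sjlt_sparsity_le sd n_gt0.
have [bad [kappa [k0 pbad good]]] := far_chords s_gt0 (mask_law_ge0 delta)
  (mask_law_sum1 sd) (mask_law_columns sd) hc0 ca (introT andP (conj d_gt0 dn))
  n_gt1 nL sm bilip As Am.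
pose x w := (sign_mask sigma w, delta_mask delta w).
have [mbad Pbad] := sjlt_prb sd bad.
(* Geodesic preservation depends on the outcome only through the two masks, which makes the event
   measurable. *)
pose Q (y : {ffun 'I_m * 'I_n -> bool} * {ffun 'I_m * 'I_n -> bool}) :=
  `[< preserves_geodesics F eps (mask_matrix s y) >].
have [mQ _] := sjlt_prb sd Q.
have QE : [set w | preserves_geodesics F eps (Phi w)] = [set w | Q (x w)].
  apply/seteqP; split => w /=; rewrite (sjlt_mask_matrix sd PhiE) => h.
    exact/asboolP.
  exact/asboolP.
have sub : ~` [set w | bad (x w)] `<=` [set w | preserves_geodesics F eps (Phi w)].
  move=> w /= /negP nb; have s0 : 0 < s%:R :> R by rewrite ltr0n.
  apply: (preserves_geodesics_far hc0 smF bilip lipd eps01 n_gt0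
    (kappa := (Num.sqrt s%:R)^-1 * kappa)).
  - exact: (frob_sjlt sd).
  - by rewrite mulr_gt0// invr_gt0 sqrtr_gt0.
  move=> u v Bu Bv uv; have [i hi] := good _ nb u v Bu Bv uv.
  rewrite -mulmxBr (sjlt_mask_matrix sd PhiE).
  apply: le_trans (ler_coord_l2norm _ i); rewrite mask_matrix_mul normrM.
  rewrite gtr0_norm ?invr_gt0 ?sqrtr_gt0// ler_wpM2l ?invr_ge0 ?sqrtr_ge0//.
  exact: ltW.
rewrite QE; apply: (@le_trans _ _ (P (~` [set w | bad (x w)]))); last first.
  by apply: le_measure; rewrite -?QE// ?QE inE//; exact: measurableC.
rewrite probability_setC// Pbad -EFinB lee_fin lerB// (le_trans pbad)//.
(* [s >= A * L ^ 2 >= 512], since [L] is positive. *)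
apply: pow2_div256_le_expR; apply: leq_trans As.
by rewrite (@leq_trans A)// ?leq_pmulr ?expn_gt0 ?L0// (@leq_trans 512)// leq_pmulr.
Qed.
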